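(* Let $V$ be a unitary vertex operator algebra of CFT type with a homogeneous orthonormal basis $\Phi$ that contains the vacuum and is fixed pointwise by the anti-linear involution of $V$. Let $\{G_N\}_{N\in\mathbb{N}}$ be a nested oligomorphic family of permutation groups $G_N$ of $X_N$. Fix, for each $n\ge 0$, an integer $N_n$ and a set $\mathcal{B}_n$ of functions as described in the context. Assume that for all $g_1,g_2,g_3\in\bigcup_n\mathcal{B}_n$ the limit $$f_{g_1g_2g_3}:=\lim_{N\to\infty} f^N_{g_1g_2g_3}$$ exists, where $f^N_{g_1g_2g_3}$ is the structure constant of the fixed point VOA $V^{G_N}$ with respect to the vectors $\phi_{g_1^N},\phi_{g_2^N},\phi_{g_3^N}$. Define $\bar V=\bigoplus_{n=0}^\infty \bar V_{(n)}$, where $\bar V_{(n)}:=\bigoplus_{g\in\mathcal{B}_n}\mathbb{C}\phi_g$ is the vector space with basis $\{\phi_g\}_{g\in\mathcal{B}_n}$, and define $Y$ bilinearly by $$Y(\phi_{g_2},z)\phi_{g_3}=\sum_{g_1\in\bigcup_n\mathcal{B}_n} f_{g_1g_2g_3}\,\phi_{g_1}\,z^{|g_1|-|g_2|-|g_3|}.$$ Then $(\bar V,Y)$ is a vertex algebra, with vacuum vector $\phi_{g_0}$, where $g_0$ is the function that is constantly equal to the vacuum of $V$.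
   Context: **Unitary VOA of CFT type.** $V=\mathbb{C}|0\rangle\oplus\bigoplus_{n\ge1}V_{(n)}$ is a vertex operator algebra with conformal vector $\omega$, an anti-linear involution $\theta$ (an anti-linear automorphism of order 2 fixing $|0\rangle$ and $\omega$, with $\theta(u_nv)=\theta(u)_n\theta(v)$), and a positive definite Hermitian form $\langle\cdot,\cdot\rangle$ (taken linear in the second argument) satisfying $\langle Y(e^{zL(1)}(-z^{-2})^{L(0)}a,z^{-1})u,v\rangle=\langle u,Y(\theta(a),z)v\rangle$ for all $a,u,v\in V$. $\Phi=\bigcup_{n\ge0}\Phi_n$ is an orthonormal basis of $V$ with $\Phi_n\subset V_{(n)}$, $\Phi_0=\{|0\rangle\}$, and $\theta(a)=a$ for all $a\in\Phi$. **Permutation groups.** $x_N$ is a strictly increasing sequence of positive integers, $X_N=\{1,\dots,x_N\}$, and $G_N$ is a permutation group of $X_N$ (acting on the right, $x\mapsto x\sigma$). $V^{G_N}$ is the fixed point sub-VOA of $V^{\otimes |X_N|}$ under $G_N$ permuting tensor factors, with the inner product induced from $V$. **Functions.** For $g:X_N\to\Phi$ put $|g|=\sum_{x\in X_N}\mathrm{wt}(g(x))$ and $\mathrm{supp}(g)=\{x: g(x)\ne|0\rangle\}$. $G_N$ acts by $(\sigma g)(x)=g(x\sigma^{-1})$. $b_n(G_N)$ is the number of $G_N$-orbits on functions of weight $|g|=n$. **Nested oligomorphic.** For $\mathcal{K}\subset X_N$, $G_N^{\mathcal K}$ and $\hat G_N^{\mathcal K}$ denote the setwise and pointwise stabilizers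 of $\mathcal K$ in $G_N$, and $G(\mathcal K)^N$ is the permutation group on $\mathcal K$ defined by the action of $G_N^{\mathcal K}/\hat G_N^{\mathcal K}$. The family $\{G_N\}$ is nested oligomorphic if (1) for every $n$, $b_n(G_N)$ converges as $N\to\infty$; (2) for every finite $\mathcal K\subset\bigcup_N X_N$ there is a group $G(\mathcal K)$ such that $G(\mathcal K)^N=G(\mathcal K)$ for $N$ large enough; (3) $G(X_{N-1})^N$ is a subgroup of $G_{N-1}$ for all $N$. **Choice of $N_n$ and $\mathcal{B}_n$.** For each $n$, $N_n$ is an integer and $\mathcal{B}_n$ is a set of representatives of the $G_{N_n}$-orbits of functions $g:X_{N_n}\to\Phi$ of weight $n$, chosen such that for every $N\ge N_n$ the functions $g^N:X_N\to\Phi$ ($g\in\mathcal{B}_n$), obtained from $g$ by setting $g^N(x)=|0\rangle$ for $x\notin X_{N_n}$, form a complete set of representatives, without repetition, of the $G_N$-orbits of functions of weight $n$ on $X_N$. **Vectors and structure constants.** For $g\in\mathcal{B}_n$ and $N\ge N_n$ let $\hat\phi_{g^N}=\bigotimes_{x\in X_N}g^N(x)$ and $\phi_{g^N}=A(g^N,N)^{-1/2}\sum_{\sigma\in G_N}\hat\phi_{\sigma g^N}\in (V^{G_N})_{(n)}$, where $A(g^N,N)>0$ is the constant making $\langle\phi_{g^N},\phi_{g^N}\rangle=1$. For $N$ large, $f^N_{g_1g_2g_3}:=\langle\phi_{g_1^N},(\phi_{g_2^N})_{|g_3|+|g_2|-|g_1|-1}\,\phi_{g_3^N}\rangle$, where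 $u_m$ are the modes of $Y(u,z)=\sum_m u_mz^{-m-1}$ in $V^{G_N}$. *)

(* Defs.v *)
From HB Require Import structures.
From mathcomp Require Import all_boot all_order all_algebra all_fingroup.
From mathcomp Require Import finmap.
From mathcomp.multinomials Require Import monalg.
From mathcomp Require Import complex.
From mathcomp Require Import boolp classical_sets functions cardinality fsbigop.
From mathcomp Require Import reals topology normedtype sequences.

Set Implicit Arguments.
Unset Strict Implicit.
Unset Printing Implicit Defensive.

Import Order.TTheory GRing.Theory Num.Theory numFieldNormedType.Exports.
Local Open Scope classical_set_scope.
Local Open Scope ring_scope.

(** * Vertex algebras

    A state-field correspondence is given by its modes:
    [Y u n v] is u_n v, where Y(u,z) = \sum_n u_n z^(-n-1). *)

Section VertexAlgebra.
Context (C : numClosedFieldType) (V : lmodType C).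
Implicit Types (u v w : V) (Y : V -> int -> V -> V).

(** The infinitesimal translation operator is T u = u_(-2)|0>.  The last axiom
    is the coefficient of z^(-m-1) w^(-n-1) in
    (z - w)^M [Y(u,z), Y(v,w)] = 0. *)
Record is_vertex_algebra (vac : V) Y : Prop := IsVertexAlgebra {
  va_linear_l : forall n v, linear (fun u => Y u n v);
  va_linear_r : forall u n, linear (Y u n);
  va_field : forall u v, exists M : nat, forall n : int, M%:Z <= n -> Y u n v = 0;
  va_vacuum : forall n v, Y vac n v = if n == -1 then v else 0;
  va_creation : forall u,
    (forall n : int, 0 <= n -> Y u n vac = 0) /\ Y u (-1) vac = u;
  va_translation : forall u n v,
    Y (Y u n v) (-2) vac - Y u n (Y v (-2) vac) = - (n%:~R *: Y u (n - 1) v);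
  va_locality : forall u v, exists M : nat, forall (m n : int) w,
    \sum_(j < M.+1) ((-1) ^+ j * 'C(M, j)%:R) *:
      (Y u (m + M%:Z - j%:Z) (Y v (n + j%:Z) w) -
       Y v (n + j%:Z) (Y u (m + M%:Z - j%:Z) w)) = 0
}.

Definition virasoro Y (omega : V) (n : int) : V -> V := Y omega (n + 1).

Definition weight_space Y (omega : V) (n : nat) : set V :=
  [set v | virasoro Y omega 0 v = n%:R *: v].

(** Vertex operator algebra of CFT type, with central charge [c]. *)
Record is_cft_voa (vac : V) Y (omega : V) (c : C) : Prop := IsCftVoa {
  voa_va : is_vertex_algebra vac Y;
  voa_virasoro : forall (m n : int) v,
    virasoro Y omega m (virasoro Y omega n v) -
    virasoro Y omega n (virasoro Y omega m v) =
    (m - n)%:~R *: virasoro Y omega (m + n) v +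
    (if m + n == 0 then ((m ^+ 3 - m)%:~R / 12%:R * c) *: v else 0);
  voa_translation : forall v, virasoro Y omega (-1) v = Y v (-2) vac;
  voa_graded : forall v, exists (k : nat) (s : nat -> V),
    (forall n, weight_space Y omega n (s n)) /\ v = \sum_(n < k) s n;
  voa_finite_dim : forall n, exists s : seq V, forall v,
    weight_space Y omega n v ->
    exists a : V -> C, v = \sum_(u <- s) a u *: u;
  voa_mode_weight : forall (k l : nat) (n : int) u v,
    weight_space Y omega k u -> weight_space Y omega l v ->
    virasoro Y omega 0 (Y u n v) = (k%:Z + l%:Z - n - 1)%:~R *: Y u n v;
  voa_vac_neq0 : vac != 0;
  voa_cft : forall v, weight_space Y omega 0%N v -> exists a : C, v = a *: vac
}.

(** The invariance axiom is
    <Y(e^(zL(1)) (-z^(-2))^(L(0)) a, z^(-1)) u, v> = <u, Y(theta a, z) v>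
    for [a] of weight [h], coefficient of z^(-n-1); L(1)^j a vanishes for
    j > h, and both sides are antilinear in [a]. *)
Record is_unitary (vac : V) Y (omega : V) (theta : V -> V) (form : V -> V -> C)
    : Prop := IsUnitary {
  theta_antilinear : forall (a : C) u v,
    theta (a *: u + v) = a^* *: theta u + theta v;
  theta_involutive : involutive theta;
  theta_vac : theta vac = vac;
  theta_omega : theta omega = omega;
  theta_mode : forall u n v, theta (Y u n v) = Y (theta u) n (theta v);
  form_linear : forall u (a : C) v w,
    form u (a *: v + w) = a * form u v + form u w;
  form_hermitian : forall u v, form v u = (form u v)^*;
  form_positive : forall u, u != 0 -> 0 < form u u;
  form_invariant : forall (h : nat) a (n : int) u v,
    weight_space Y omega h a ->
    form (\sum_(j < h.+1) ((-1) ^+ h / (j`!)%:R) *: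
            Y (iter j (virasoro Y omega 1) a)
              (2%:Z * h%:Z - j%:Z - n - 2%:Z) u) v =
    form u (Y (theta a) n v)
}.

End VertexAlgebra.

Record unitary_voa (C : numClosedFieldType) := UnitaryVoa {
  uv_space :> lmodType C;
  vacuum : uv_space;
  mode : uv_space -> int -> uv_space -> uv_space;
  conformal : uv_space;
  central_charge : C;
  invol : uv_space -> uv_space;
  form : uv_space -> uv_space -> C;
  uv_voa : is_cft_voa vacuum mode conformal central_charge;
  uv_unitary : is_unitary vacuum mode conformal invol form
}.
Arguments vacuum {C} _.
Arguments conformal {C} _.

(** The orthonormal basis, as the family of its weight-[n] parts (finite, since
    the weight spaces are finite-dimensional). *)
Record homogeneous_onb (C : numClosedFieldType) (V : unitary_voa C) :=
  HomogeneousOnb {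
  onb :> nat -> {fset V};
  onb_weight : forall n v, v \in onb n ->
    weight_space (@mode C V) (conformal V) n v;
  onb_vacuum : onb 0%N = [fset vacuum V]%fset;
  onb_orthonormal : forall m n u v, u \in onb m -> v \in onb n ->
    form u v = (u == v)%:R;
  onb_span : forall v : V, exists (s : seq V) (a : V -> C),
    (forall u, u \in s -> exists n, u \in onb n) /\ v = \sum_(u <- s) a u *: u;
  onb_invol : forall n v, v \in onb n -> invol v = v
}.

(** The set underlying a homogeneous basis; each element carries its weight. *)
Definition elt (C : numClosedFieldType) (V : unitary_voa C)
  (Phi : homogeneous_onb V) := {n : nat & Phi n}.

HB.instance Definition _ (C : numClosedFieldType) (V : unitary_voa C)
  (Phi : homogeneous_onb V) := Choice.on (elt Phi).

Section Basis.
Context (C : numClosedFieldType) (V : unitary_voa C) (Phi : homogeneous_onb V).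

Definition elt_val (p : elt Phi) : V := val (tagged p).
Definition elt_wt (p : elt Phi) : nat := tag p.

Lemma vacuum_in_onb : vacuum V \in Phi 0%N.
Proof. by rewrite onb_vacuum inE. Qed.

Definition elt_vac : elt Phi := Tagged (fun n => Phi n) [` vacuum_in_onb]%fset.

End Basis.

(** * Functions to the basis, their weights and orbits *)

Section Functions.
Context (C : numClosedFieldType) (V : unitary_voa C) (Phi : homogeneous_onb V).
Context (X : finType).
Implicit Types (g h : {ffun X -> elt Phi}) (G : {group {perm X}}).

Definition fwt g : nat := (\sum_x elt_wt (g x))%N.

(** Permutations act on points from the right, x sigma = [sigma x]. *)
Definition fact (sigma : {perm X}) g : {ffun X -> elt Phi} :=
  [ffun x => g ((sigma^-1)%g x)].

Lemma factM (s t : {perm X}) g : fact s (fact t g) = fact (t * s)%g g.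
Proof. by apply/ffunP => x; rewrite !ffunE invMg permM. Qed.

Lemma fact1 g : fact 1%g g = g.
Proof. by apply/ffunP => x; rewrite !ffunE invg1 perm1. Qed.

Lemma factK (s : {perm X}) : cancel (fact s^-1%g : {ffun X -> elt Phi} -> _) (fact s).
Proof. by move=> g; rewrite factM mulVg fact1. Qed.

Definition forbit G g : set {ffun X -> elt Phi} :=
  [set fact sigma g | sigma in [set sigma | sigma \in G]].

(** The set of orbits is finite, so [fset_set] gives its true cardinal. *)
Definition orbit_count G (n : nat) : nat :=
  #|` fset_set [set forbit G g | g in [set g | fwt g = n]] |.

End Functions.

(** * The tensor power of V and its fixed points

    V^(tensor X) is the space with basis the elementary tensors
    [<< g >>] = \bigotimes_x g(x), for g : X -> Phi. *)

Section Tensor.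
Context (C : numClosedFieldType) (V : unitary_voa C) (Phi : homogeneous_onb V).
Context (X : finType).
Implicit Types (g h : {ffun X -> elt Phi}).

Definition tpow := {malg C[{ffun X -> elt Phi}]}.
HB.instance Definition _ := GRing.Lmodule.on tpow.
Implicit Types (u v : tpow).

(** \bigotimes_x a(x); the coordinates of a(x) in the orthonormal basis are the
    <p, a(x)>, and only finitely many of the summands are nonzero. *)
Definition tens (a : X -> V) : tpow :=
  \sum_(g \in [set: {ffun X -> elt Phi}])
    (\prod_x form (elt_val (g x)) (a x)) *: (<< g >> : tpow).

(** Modes of Y(\bigotimes_x a(x), z) = \bigotimes_x Y(a(x), z): the coefficient
    of z^(-m-1) collects the families k of mode indices with
    \sum_x (- k(x) - 1) = - m - 1.  By truncation only finitely many of
    them contribute. *)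
Definition tens_mode (a : X -> V) (m : int) (b : X -> V) : tpow :=
  \sum_(k \in [set k : {ffun X -> int} | \sum_x (k x + 1) = m + 1])
    tens (fun x => mode (a x) (k x) (b x)).

Definition tmode (u : tpow) (m : int) (v : tpow) : tpow :=
  \sum_(g <- msupp u) \sum_(h <- msupp v)
    (mcoeff g u * mcoeff h v) *:
      tens_mode (fun x => elt_val (g x)) m (fun x => elt_val (h x)).

Definition tform (u v : tpow) : C :=
  \sum_(g <- msupp u) \sum_(h <- msupp v)
    (mcoeff g u)^* * mcoeff h v *
      \prod_x form (elt_val (g x)) (elt_val (h x)).

Definition tperm_act (sigma : {perm X}) (u : tpow) : tpow :=
  \sum_(g <- msupp u) mcoeff g u *: (<< fact sigma g >> : tpow).

Lemma mcoeff_tperm_act (s : {perm X}) u h :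
  mcoeff h (tperm_act s u) = mcoeff (fact s^-1%g h) u.
Proof.
rewrite /tperm_act raddf_sum /=.
have E g : g \in msupp u -> mcoeff h (mcoeff g u *: (<< fact s g >> : tpow)) =
   if g == fact s^-1%g h then mcoeff g u else 0.
  move=> _; rewrite mcoeffZ mcoeffU.
  have -> : (fact s g == h) = (g == fact s^-1%g h).
    apply/eqP/eqP => [<-|->]; by rewrite factM ?mulgV ?mulVg fact1.
  by case: eqP => _ /=; rewrite ?mulr1 ?mulr0.
rewrite big_seq (eq_bigr _ E) -big_seq -big_mkcond /=.
have [Hin|Hout] := boolP (fact s^-1%g h \in msupp u).
  by rewrite -big_filter filter_pred1_uniq ?fset_uniq // big_seq1.
rewrite mcoeff_outdom // big_seq_cond big1 // => g /andP[gu /eqP Eg].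
by rewrite -Eg gu in Hout.
Qed.

(** V^G.  Its modes and inner product are the restrictions of [tmode] and
    [tform]. *)
Definition fixed_points (G : {group {perm X}}) : set tpow :=
  [set u | forall sigma, sigma \in G -> tperm_act sigma u = u].

Definition orbit_sum (G : {group {perm X}}) g : tpow :=
  \sum_(sigma in G) (<< fact sigma g >> : tpow).

(** A(g)^(-1/2) \sum_sigma \hat\phi_(sigma g): the norm is 1 exactly for
    A(g) = <S, S>, where S is the sum over the group. *)
Definition orbit_vec (G : {group {perm X}}) g : tpow :=
  (sqrtC (tform (orbit_sum G g) (orbit_sum G g)))^-1 *: orbit_sum G g.

Lemma orbit_vec_fixed (G : {group {perm X}}) g :
  fixed_points G (orbit_vec G g).
Proof.
move=> s sG; apply/malgP => h; rewrite mcoeff_tperm_act !mcoeffZ.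
congr (_ * _); rewrite /orbit_sum !raddf_sum /= (reindex_inj (mulIg s^-1%g)) /=.
apply: eq_big => [t|t tG]; first by rewrite groupMr // groupV.
by rewrite !mcoeffU -factM (can_eq (factK s)).
Qed.

(** <phi_1, (phi_2)_m phi_3> in V^G, for m = |g3| + |g2| - |g1| - 1. *)
Definition orbit_structure_const (G : {group {perm X}}) g1 g2 g3 : C :=
  tform (orbit_vec G g1)
    (tmode (orbit_vec G g2) ((fwt g3)%:Z + (fwt g2)%:Z - (fwt g1)%:Z - 1)
       (orbit_vec G g3)).

End Tensor.

(** * Families of permutation groups

    The set X_N = {1, ..., x_N} is represented by ['I_(x N)], so the union of
    the X_N is [nat]. *)

Definition perm_nat n (sigma : 'S_n) (k : nat) : nat :=
  if insub k is Some i then val (sigma i) else k.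

(** The permutation group of the finite set e(K) of naturals defined by the
    elements of G that stabilize e(K). *)
Definition induced_perms n (G : {group 'S_n}) (K : finType) (e : K -> nat)
    : {set {perm K}} :=
  [set tau : {perm K} | [exists sigma in G,
     [forall k : K, perm_nat sigma (e k) == e (tau k)]]]%SET.

Section Limit.
Context (R : realType) (V : unitary_voa R[i]) (Phi : homogeneous_onb V).
Context (x : nat -> nat).

Record nested_oligomorphic (G : forall N, {group 'S_(x N)}) : Prop :=
  NestedOligomorphic {
  no_orbits : forall n,
    cvgn (fun N => (orbit_count Phi (G N) n)%:R : R);
  no_stable : forall K : {fset nat}, exists H : {group {perm K}},
    exists N0, forall N, (N0 <= N)%N -> induced_perms (G N) (val : K -> nat) = H;
  no_nested : forall N,
    induced_perms (G N.+1) (val : 'I_(x N) -> nat) \subset G N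
}.

(** g^N: extension by the vacuum. *)
Definition vac_ext n (g : {ffun 'I_n -> elt Phi}) (N : nat)
    : {ffun 'I_(x N) -> elt Phi} :=
  [ffun i : 'I_(x N) => if insub (val i) is Some j then g j else elt_vac Phi].

Definition orbit_representatives (G : forall N, {group 'S_(x N)})
    (Nn : nat -> nat) (B : forall n, {pred {ffun 'I_(x (Nn n)) -> elt Phi}}) :=
  forall n N, (Nn n <= N)%N ->
  [/\ forall g, g \in B n -> fwt g = n,
      forall h : {ffun 'I_(x N) -> elt Phi}, fwt h = n ->
        exists2 g, g \in B n & forbit (G N) (vac_ext g N) h
    & forall g1 g2, g1 \in B n -> g2 \in B n ->
        forbit (G N) (vac_ext g1 N) (vac_ext g2 N) -> g1 = g2].

Section Reps.
Context (Nn : nat -> nat) (B : forall n, {pred {ffun 'I_(x (Nn n)) -> elt Phi}}).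

(** The union of the B_n. *)
Definition reps := {n : nat & {g : {ffun 'I_(x (Nn n)) -> elt Phi} | g \in @B n}}.
HB.instance Definition _ := Choice.on reps.

Definition rep_fun (g : reps) : {ffun 'I_(x (Nn (tag g))) -> elt Phi} :=
  val (tagged g).

Definition structure_const (G : forall N, {group 'S_(x N)}) (g1 g2 g3 : reps)
    (N : nat) : R[i]^o :=
  orbit_structure_const (G N)
    (vac_ext (rep_fun g1) N) (vac_ext (rep_fun g2) N) (vac_ext (rep_fun g3) N).

Definition limit_space := {malg R[i][reps]}.
HB.instance Definition _ := GRing.Lmodule.on limit_space.

Definition limit_vec (g : reps) : limit_space := << g >>.

(** The coefficient of z^(-m-1) selects |g1| - |g2| - |g3| = - m - 1. *)
Definition limit_mode (f : reps -> reps -> reps -> R[i])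
    (u : limit_space) (m : int) (v : limit_space) : limit_space :=
  \sum_(g2 <- msupp u) \sum_(g3 <- msupp v)
    (mcoeff g2 u * mcoeff g3 v) *:
      \sum_(g1 \in [set g1 : reps |
              (fwt (rep_fun g1))%:Z - (fwt (rep_fun g2))%:Z
              - (fwt (rep_fun g3))%:Z = - m - 1])
        f g1 g2 g3 *: limit_vec g1.

End Reps.
End Limit.

(* Main.v *)
(** Let c(p; q, r) be the coefficient of p in the product q_(n) r of three basis
    vectors.  The weights force n, so the axioms of a vertex algebra become
    identities between the numbers c; locality of order M says that the two
    four-point functions of q and r, as functions of the weight of the
    intermediate state, have the same M-th difference.  The constants of a tensor
    power are products over the sites, hence so are the generating functions of
    its four-point functions: orders of locality add up over the sites.  Since the
    vacuum is local of order 0 to everything, the order for two functions g, h is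
    bounded in terms of |g| and |h| alone, uniformly in N.  A sum over orbit
    representatives of products of normalized orbit constants equals an average
    over G_N of the corresponding sum over all functions, so the orbit constants
    satisfy the same identities; these involve finitely many representatives and
    pass to the limit. *)

From HB Require Import structures.
Require Import Defs.
From mathcomp Require Import all_boot all_order all_algebra all_fingroup.
From mathcomp Require Import finmap.
From mathcomp.multinomials Require Import monalg.
From mathcomp Require Import complex.
From mathcomp Require Import boolp classical_sets functions cardinality fsbigop.
From mathcomp Require Import reals topology normedtype sequences.
From mathcomp Require Import zify ring.
Set Implicit Arguments.
Unset Strict Implicit.
Unset Printing Implicit Defensive.

Import Order.TTheory GRing.Theory Num.Theory numFieldNormedType.Exports.
Local Open Scope classical_set_scope.
Local Open Scope ring_scope.

(** * Differences and generating functions *)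

(** The two orderings of a four-point function are series in opposite directions, so a relation
    between them does not multiply over the sites as it stands. What multiplies is their common
    numerator. If A and B are the two series in the weight of the intermediate state and D is the
    sum of the outer weights, locality of order M says that (1 - X)^M A is a polynomial of degree at
    most D + M whose reversal is (X - 1)^M B. Reversal is multiplicative once degree bounds are
    carried along, and D and M both add over the sites. A bound on M independent of N is what the
    limit requires: an M-th difference has M + 1 terms, and this number may not grow with N. The
    passage from representatives to all functions is exact because A(g) = |G_N| |Stab(g)|: two
    normalizing factors together with two group sums of invariant functions contribute |G_N| /
    |Stab(g)|, the length of the orbit. *)

Section Differences.
Context (K : comNzRingType).
Implicit Types (F A B : int -> K) (k : int) (p q : {poly K}).

Definition delta F : int -> K := fun k => F k - F (k - 1).

Lemma iter_deltaE M F k :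
  iter M delta F k = \sum_(j < M.+1) ((-1) ^+ j * 'C(M, j)%:R) * F (k - j%:Z).
Proof.
elim: M k => [|M IH] k.
  by rewrite big_ord1 /= expr0 bin0 !mul1r subr0.
rewrite iterS /delta !IH big_ord_recl /= [in RHS]big_ord_recl /=.
rewrite !bin0 !expr0 !mul1r -addrA; congr (_ + _).
rewrite [in X in _ - X]big_ord_recr /= [in RHS]big_ord_recr /=.
have -> : \sum_(i < M) (-1) ^+ bump 0 i * 'C(M, bump 0 i)%:R * F (k - (bump 0 i)%:Z)
   - (\sum_(i < M) (-1) ^+ i * 'C(M, i)%:R * F (k - 1 - i%:Z)
     + (-1) ^+ M * 'C(M, M)%:R * F (k - 1 - M%:Z)) =
   (\sum_(i < M) ((-1) ^+ bump 0 i * 'C(M, bump 0 i)%:R * F (k - (bump 0 i)%:Z)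
   - (-1) ^+ i * 'C(M, i)%:R * F (k - 1 - i%:Z)))
     - (-1) ^+ M * 'C(M, M)%:R * F (k - 1 - M%:Z).
  by rewrite sumrB opprD addrA.
congr (_ + _); last first.
  rewrite /bump /= add1n !binn exprS mulN1r !mulr1 mulNr.
  by congr (- (_ * F _)); rewrite -addn1 PoszD; ring.
apply: eq_bigr => i _; rewrite /bump /= add1n binS natrD.
have -> : k - 1 - i%:Z = k - i.+1%:Z by rewrite -addn1 PoszD; ring.
by rewrite exprS; ring.
Qed.

Lemma eq_iter_delta M F1 F2 k :
  (forall i, i <= k -> F1 i = F2 i) -> iter M delta F1 k = iter M delta F2 k.
Proof.
move=> eqF; rewrite !iter_deltaE; apply: eq_bigr => j _.
by congr (_ * _); apply: eqF; lia.
Qed.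

Lemma iter_delta_eq0 M F k :
  (forall i, i <= k -> F i = 0) -> iter M delta F k = 0.
Proof.
by move=> F0; rewrite iter_deltaE big1 // => j _; rewrite F0 ?mulr0 //; lia.
Qed.

(** Reflection turns a backward difference into minus a backward difference taken one index higher;
    M steps give the sign and the shift by M. *)
Lemma iter_delta_reflect M F (D : int) k :
  iter M delta (fun i => F (D - i)) k =
  (-1) ^+ M * iter M delta F (D + M%:Z - k).
Proof.
elim: M k => [|M IH] k /=; first by rewrite expr0 mul1r addr0.
rewrite /delta !IH exprS.
have -> : D + M%:Z - (k - 1) = D + M.+1%:Z - k by lia.
have -> : D + M.+1%:Z - k - 1 = D + M%:Z - k by lia.
ring.
Qed.

(** [A k] and [B k] are the contributions of the intermediate states of weight
    [k] to the two orderings of a four-point function whose outer weights add up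
    to [D]; an identity between their [M]-th differences is the locality of
    order [M]. *)
Definition local_pair (M : nat) (D : int) A B :=
  forall k, iter M delta A k = iter M delta (fun i => B (D - i)) k.

Lemma local_pairS M D A B : local_pair M D A B -> local_pair M.+1 D A B.
Proof. by move=> h k; rewrite !iterS /delta !h. Qed.

Lemma local_pairW M M' D A B :
  (M <= M')%N -> local_pair M D A B -> local_pair M' D A B.
Proof.
move=> /subnK <-; elim: (M' - M)%N => // n IH /IH.
exact: local_pairS.
Qed.

Definition icoef p k : K := if k is Posz n then p`_n else 0.

Lemma icoef_delta M p k :
  icoef ((1 - 'X) ^+ M * p) k = iter M delta (icoef p) k.
Proof.
elim: M k => [|M IH] k; first by rewrite expr0 mul1r.
rewrite iterS /delta -!IH exprS -mulrA; move: (_ ^+ _ * p) => q.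
rewrite mulrBl mul1r.
case: k => [[|k]|k] /=; rewrite ?coefB ?coefXM ?subr0 //=.
by rewrite subn1.
Qed.

Definition truncation L A : {poly K} := \poly_(i < L) A i%:Z.

Definition eq_upto L p q := forall i, (i < L)%N -> p`_i = q`_i.

Lemma eq_upto_mul L p p' q q' :
  eq_upto L p p' -> eq_upto L q q' -> eq_upto L (p * q) (p' * q').
Proof.
move=> hp hq i iL; rewrite !coefM; apply: eq_bigr => j _.
have ji := ltn_ord j; rewrite hp ?hq //; lia.
Qed.

Lemma eq_upto_prod (X : finType) L (p q : X -> {poly K}) :
  (forall x, eq_upto L (p x) (q x)) -> eq_upto L (\prod_x p x) (\prod_x q x).
Proof.
by move=> h; elim/big_ind2: _ => // p1 p2 q1 q2; exact: eq_upto_mul.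
Qed.

(** A backward difference at [k] looks only at indices up to [k], so cutting the series off at
    [L > k] is harmless. *)
Lemma coef_delta_truncation M L A (k : nat) : (forall i, i < 0 -> A i = 0) -> (k < L)%N ->
  ((1 - 'X) ^+ M * truncation L A)`_k = iter M delta A k%:Z.
Proof.
move=> A0 kL; have /= -> := icoef_delta M (truncation L A) k%:Z.
apply: eq_iter_delta => -[i|i] ik /=; last by rewrite A0.
by rewrite coef_poly ifT //; lia.
Qed.

(** This is X^D p(1/X) when p has degree at most D. *)
Definition rev_poly D p : {poly K} := \poly_(i < D.+1) p`_(D - i).

Lemma rev_poly_mul D E p q : (size p <= D.+1)%N -> (size q <= E.+1)%N ->
  rev_poly (D + E) (p * q) = rev_poly D p * rev_poly E q.
Proof.
move=> sp sq.
have revE (F : nat) (r : {poly K}) : (size r <= F.+1)%N ->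
    rev_poly F r = \sum_(i < F.+1) r`_i *: 'X^(F - i).
  move=> sr; rewrite /rev_poly poly_def (reindex_inj rev_ord_inj) /=.
  apply: eq_bigr => i _; rewrite subSS subKn //; exact: (ltn_ord i).
have polyE (F : nat) (r : {poly K}) : (size r <= F.+1)%N -> r = \sum_(i < F.+1) r`_i *: 'X^i.
  move=> sr; rewrite -poly_def; apply/polyP => i; rewrite coef_poly.
  case: ltnP => // hi; rewrite nth_default //; exact: leq_trans hi.
rewrite (revE D) // (revE E) // {1}(polyE D p) // {1}(polyE E q) //.
have revD (F : nat) (r s : {poly K}) : rev_poly F (r + s) = rev_poly F r + rev_poly F s.
  by apply/polyP => i; rewrite coefD !coef_poly; case: ifP; rewrite ?coefD ?addr0.
have rev0 (F : nat) : rev_poly F 0 = 0.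
  by apply/polyP => i; rewrite coef_poly !coef0; case: ifP.
rewrite !mulr_suml (big_morph _ (revD _) (rev0 _)); apply: eq_bigr => i _.
rewrite !mulr_sumr (big_morph _ (revD _) (rev0 _)); apply: eq_bigr => j _.
rewrite -!scalerAl -!scalerAr !scalerA -!exprD.
apply/polyP => k; rewrite coef_poly !coefZ !coefXn.
have := ltn_ord i; have := ltn_ord j => hj hi.
case: ltnP => hk.
  by congr (_ * (nat_of_bool _)%:R); apply/eqP/eqP; lia.
by rewrite (_ : (k == _) = false) ?mulr0 //; apply/eqP; lia.
Qed.

(** Size and reversal go through one induction, since reversal is multiplicative only under the size
    bounds. *)
Lemma rev_poly_prod (X : finType) (D : X -> nat) (p : X -> {poly K}) :
  (forall x, (size (p x) <= (D x).+1)%N) ->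
  (size (\prod_x p x)%R <= (\sum_x D x).+1)%N /\
  rev_poly (\sum_x D x) (\prod_x p x) = \prod_x rev_poly (D x) (p x).
Proof.
move=> sp.
pose P (n : nat) (r s : {poly K}) := (size r <= n.+1)%N /\ rev_poly n r = s.
suff: P (\sum_x D x)%N (\prod_x p x) (\prod_x rev_poly (D x) (p x)) by [].
apply: (big_ind3 P) => //.
- split; first by rewrite size_poly1.
  by apply/polyP => -[|i]; rewrite coef_poly ?coef1.
- move=> n r s n' r' s' [sr <-] [sr' <-]; split; last exact: rev_poly_mul.
  apply: leq_trans (size_polyMleq _ _) _; lia.
Qed.

Lemma local_pair_prod (X : finType) (M D : X -> nat) (A B : X -> int -> K)
    (A' B' : int -> K) :
  (forall x k, k < 0 -> A x k = 0) -> (forall x k, k < 0 -> B x k = 0) ->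
  (forall k, k < 0 -> A' k = 0) -> (forall k, k < 0 -> B' k = 0) ->
  (forall L (k : nat), (k < L)%N -> A' k%:Z = (\prod_x truncation L (A x))`_k) ->
  (forall L (k : nat), (k < L)%N -> B' k%:Z = (\prod_x truncation L (B x))`_k) ->
  (forall x, local_pair (M x) (D x)%:Z (A x) (B x)) ->
  local_pair (\sum_x M x) (\sum_x D x)%N%:Z A' B'.
Proof.
move=> A0 B0 A'0 B'0 hA hB loc.
pose E x := (D x + M x)%N.
(* The common numerator at [x]: the difference of [A x] vanishes below 0, and also above [E x],
   where locality makes it a difference of [B x] at negative indices. *)
pose P x := \poly_(i < (E x).+1) iter (M x) delta (A x) i%:Z.
have EE : (\sum_x E x = \sum_x D x + \sum_x M x)%N by rewrite big_split.
have sP x : (size (P x) <= (E x).+1)%N by exact: size_poly.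
have [sPP revP] := rev_poly_prod sP.
have locE x (k : int) : iter (M x) delta (A x) k =
    (-1) ^+ M x * iter (M x) delta (B x) ((E x)%:Z - k).
  by rewrite loc iter_delta_reflect -PoszD.
have PA L x : eq_upto L ((1 - 'X) ^+ M x * truncation L (A x)) (P x).
  move=> i iL; rewrite coef_delta_truncation //; last exact: A0.
  rewrite coef_poly; case: ltnP => // iE.
  rewrite locE iter_delta_eq0 ?mulr0 // => j jE; apply: B0; lia.
(* Using ['X - 1] in place of [1 - 'X] absorbs the sign that the reflection produces. *)
have PB L x :
    eq_upto L (('X - 1) ^+ M x * truncation L (B x)) (rev_poly (E x) (P x)).
  move=> i iL; rewrite -opprB exprNn -mulrA -(rmorph_sign (@polyC K)) coefCM.
  rewrite coef_delta_truncation //; last exact: B0.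
  rewrite coef_poly; case: ltnP => iE.
    rewrite coef_poly ifT ?locE; last by lia.
    by have -> : (E x)%:Z - (E x - i)%N%:Z = i%:Z by lia.
  have -> : i%:Z = (E x)%:Z - ((E x)%:Z - i%:Z) by lia.
  rewrite -locE iter_delta_eq0 // => j jE; apply: A0; lia.
have eqtr L (F : int -> K) (Fx : X -> int -> K) :
    (forall L (k : nat), (k < L)%N -> F k%:Z = (\prod_x truncation L (Fx x))`_k) ->
    eq_upto L (truncation L F) (\prod_x truncation L (Fx x)).
  by move=> hF i iL; rewrite coef_poly iL; exact: hF.
have TA L : eq_upto L ((1 - 'X) ^+ (\sum_x M x)%N * truncation L A') (\prod_x P x).
  move=> i iL; rewrite -(eq_upto_prod (PA L)) // big_split /= -expr_sum.
  exact: (eq_upto_mul (fun _ _ => erefl) (eqtr _ _ _ hA)).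
have TB L : eq_upto L (('X - 1) ^+ (\sum_x M x)%N * truncation L B')
    (rev_poly (\sum_x E x) (\prod_x P x)).
  move=> i iL; rewrite revP -(eq_upto_prod (PB L)) // big_split /= -expr_sum.
  exact: (eq_upto_mul (fun _ _ => erefl) (eqtr _ _ _ hB)).
have TA' (k : nat) : iter (\sum_x M x) delta A' k = (\prod_x P x)`_k.
  by rewrite -(TA k.+1) // coef_delta_truncation.
have TB' (k : nat) : (-1) ^+ (\sum_x M x)%N * iter (\sum_x M x) delta B' k =
    (rev_poly (\sum_x E x) (\prod_x P x))`_k.
  rewrite -(TB k.+1) // -opprB [in RHS]exprNn -mulrA -(rmorph_sign (@polyC K)) coefCM.
  by rewrite coef_delta_truncation.
move=> k; rewrite iter_delta_reflect -PoszD -EE.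
(* Below 0 and above the degree bound both sides vanish; in between they are the same coefficient of
   the product of the numerators. *)
case: k => k; last first.
  rewrite iter_delta_eq0 => [|j jk]; last by apply: A'0; lia.
  have -> : (\sum_x E x)%N%:Z - Negz k = ((\sum_x E x) + k.+1)%N by lia.
  by rewrite TB' coef_poly ifF //; lia.
have [kE|kE] := leqP k (\sum_x E x)%N.
  rewrite TA' subzn // TB' coef_poly ifT; last by lia.
  by congr (_`_ _); lia.
rewrite TA' nth_default; last exact: leq_trans sPP kE.
rewrite iter_delta_eq0 ?mulr0 // => j jk; apply: B'0; lia.
Qed.

End Differences.

(** * Vertex algebras from structure constants *)

Section LinearExtension.
Context (C : nzRingType) (I : choiceType).
Implicit Types (u v : {malg C[I]}).

Definition mlift (W : lmodType C) (F : I -> W) u : W :=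
  \sum_(g <- msupp u) mcoeff g u *: F g.

Lemma mliftEw (W : lmodType C) (F : I -> W) (d : {fset I}) u :
  {subset msupp u <= d} -> mlift F u = \sum_(g <- d) mcoeff g u *: F g.
Proof.
move=> sud; apply: big_fset_incl; first by apply/fsubsetP.
by move=> g _ /mcoeff_outdom ->; rewrite scale0r.
Qed.

Lemma mlift_is_linear (W : lmodType C) (F : I -> W) : linear (mlift F).
Proof.
move=> a u v; pose d := (msupp u `|` msupp v `|` msupp (a *: u + v))%fset.
rewrite !(@mliftEw W F d) => [|g|g|g]; try by rewrite !in_fsetU => ->; rewrite ?orbT.
rewrite scaler_sumr -big_split /=; apply: eq_bigr => g _.
by rewrite mcoeffD mcoeffZ scalerDl scalerA.
Qed.

HB.instance Definition _ (W : lmodType C) (F : I -> W) :=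
  GRing.isLinear.Build C {malg C[I]} W *:%R (mlift F) (@mlift_is_linear W F).

Lemma mcoeff_basis g h : (<< g >> : {malg C[I]})@_h = (g == h)%:R.
Proof. exact: mcoeffU. Qed.

Lemma mliftU (W : lmodType C) (F : I -> W) g : mlift F << g >> = F g.
Proof. by rewrite /mlift msuppU oner_eq0 big_seq_fset1 mcoeffUU scale1r. Qed.

Lemma mlift_id u : mlift (fun g => << g >>) u = u.
Proof.
apply/malgP => k; rewrite raddf_sum /= [in RHS](monalgE u) raddf_sum /=.
by apply: eq_bigr => g _; rewrite mcoeffZ mcoeff_basis mcoeffU mulr_natr.
Qed.

(** Vanishing is asked only on the support of [u], so that bounds on modes and orders of locality
    may be chosen from that support. *)
Lemma linear_malg_eq0 (W : lmodType C) (F : {malg C[I]} -> W) u :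
  linear F -> (forall g, g \in msupp u -> F << g >> = 0) -> F u = 0.
Proof.
move=> linF F0.
pose F' : {linear {malg C[I]} -> W} := HB.pack F (GRing.isLinear.Build C _ W _ F linF).
rewrite -[u]mlift_id -[F _]/(F' _) linear_sum big_seq big1 // => g gu.
by rewrite linearZ /= F0 ?scaler0.
Qed.

End LinearExtension.

Section Levels.
Context (I : choiceType) (wt : I -> nat).

Definition finite_levels := forall n, finite_set [set i | wt i = n].

(** Weights are compared in the integers, so that the levels of negative weight
    are empty. *)
Definition level (k : int) : {fset I} := fset_set [set i | (wt i)%:Z = k].

Hypothesis fin : finite_levels.

Lemma finite_level k : finite_set [set i | (wt i)%:Z = k].
Proof.
apply: (@sub_finite_set _ _ [set i | wt i = `|k|%N]); last exact: fin.
by move=> i /= <-.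
Qed.

Lemma mem_level k i : (i \in level k) = ((wt i)%:Z == k).
Proof.
rewrite in_fset_set; last exact: finite_level.
by apply/idP/eqP; rewrite inE.
Qed.

Lemma sum_level_neg (M : nmodType) (F : I -> M) k :
  k < 0 -> \sum_(i <- level k) F i = 0.
Proof.
move=> k0; rewrite big_seq big1 // => i; rewrite mem_level => /eqP E.
by rewrite -E in k0.
Qed.

End Levels.

Section VertexConstants.
Context (C : numClosedFieldType) (I : choiceType) (wt : I -> nat).
Implicit Types (c : I -> I -> I -> C) (p q r s l : I).

(** The part of <p, Y(q,z) Y(r,w) l> that passes through intermediate states of weight [k]. *)
Definition four_point c p q r l (k : int) : C :=
  \sum_(s <- level wt k) c p q s * c s r l.

(** [c p q r] is the coefficient of [p] in the product q_(n) r, whose mode [n]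
    is determined by the weights. *)
Record vertex_constants (mu : I -> I -> nat) (vac : I) c : Prop := VertexConstants {
  vc_wt_vac : wt vac = 0%N;
  vc_vacuum : forall p r, c p vac r = (p == r)%:R;
  vc_creation : forall p q, (wt p <= wt q)%N -> c p q vac = (p == q)%:R;
  vc_translation : forall p q r,
    \sum_(s <- level wt ((wt p)%:Z - 1)) c p s vac * c s q r -
    \sum_(s <- level wt ((wt r)%:Z + 1)) c p q s * c s r vac =
    ((wt p)%:Z - (wt q)%:Z - (wt r)%:Z)%:~R * c p q r;
  vc_local : forall p q r l,
    local_pair (mu q r) (wt p + wt l)%N%:Z (four_point c p q r l) (four_point c p r q l)
}.

(** Written with the same sums as [limit_mode], so that the two are convertible when [wt] is the
    weight of representatives. *)
Definition constants_mode c (u : {malg C[I]}) (m : int) (v : {malg C[I]}) : {malg C[I]} :=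
  \sum_(q <- msupp u) \sum_(r <- msupp v)
    (mcoeff q u * mcoeff r v) *:
      \sum_(p \in [set p | (wt p)%:Z - (wt q)%:Z - (wt r)%:Z = - m - 1])
        c p q r *: << p >>.

Hypothesis fin : finite_levels wt.

Definition basis_mode c q (m : int) r : {malg C[I]} :=
  \sum_(p <- level wt ((wt q)%:Z + (wt r)%:Z - m - 1)) c p q r *: << p >>.

Lemma constants_modeE c u m v :
  constants_mode c u m v = mlift (fun q => mlift (basis_mode c q m) v) u.
Proof.
apply: eq_bigr => q _; rewrite scaler_sumr; apply: eq_bigr => r _.
rewrite scalerA; congr (_ *: _); rewrite /basis_mode /level.
rewrite (_ : [set i | _] = [set p | (wt p)%:Z - (wt q)%:Z - (wt r)%:Z = - m - 1]).
  rewrite fsbig_finite //; apply: sub_finite_set (finite_level fin ((wt q)%:Z + (wt r)%:Z - m - 1)).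
  by move=> p /= E; lia.
by apply/seteqP; split => p /= E; lia.
Qed.

Lemma mcoeff_basis_mode c p q m r : (basis_mode c q m r)@_p =
  if (wt p)%:Z == (wt q)%:Z + (wt r)%:Z - m - 1 then c p q r else 0.
Proof.
rewrite raddf_sum /=; under eq_bigr do rewrite mcoeffZ mcoeff_basis mulr_natr mulrb.
rewrite -big_mkcond /=; case: ifP; rewrite -(mem_level fin) => hp.
  by rewrite -big_filter filter_pred1_uniq ?fset_uniq // big_seq1.
by rewrite big_seq_cond big1 // => s /andP[hs /eqP E]; rewrite -E hs in hp.
Qed.

Lemma constants_mode_linear_l c m v : linear (fun u => constants_mode c u m v).
Proof. by move=> a u u'; rewrite !constants_modeE linearP. Qed.

Lemma constants_mode_linear_r c u m : linear (constants_mode c u m).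
Proof.
move=> a v v'; rewrite !constants_modeE scaler_sumr -big_split /=.
by apply: eq_bigr => q _; rewrite linearP scalerDr !scalerA mulrC.
Qed.

Lemma constants_modeU c q m r : constants_mode c << q >> m << r >> = basis_mode c q m r.
Proof. by rewrite constants_modeE !mliftU. Qed.

HB.instance Definition _ c u m := GRing.isLinear.Build C {malg C[I]} {malg C[I]}
  *:%R (constants_mode c u m) (@constants_mode_linear_r c u m).

(** The inner mode fixes the weight of the intermediate state; the condition left by the outer mode
    is then the same for all these states. *)
Lemma mcoeff_mode_basis_r c p q r l a b :
  (constants_mode c << q >> a (basis_mode c r b l))@_p =
  if (wt p)%:Z == (wt q)%:Z + (wt r)%:Z + (wt l)%:Z - a - b - 2
  then four_point c p q r l ((wt r)%:Z + (wt l)%:Z - b - 1) else 0.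
Proof.
rewrite /four_point [basis_mode c r b l]/basis_mode linear_sum raddf_sum; case: ifPn => h.
  apply: eq_big_seq => s; rewrite (mem_level fin) => /eqP hs.
  rewrite linearZ /= constants_modeU mcoeffZ mcoeff_basis_mode mulrC ifT //; lia.
rewrite big_seq big1 // => s; rewrite (mem_level fin) => /eqP hs.
rewrite linearZ /= constants_modeU mcoeffZ mcoeff_basis_mode ifF ?mulr0 //.
apply/negbTE; lia.
Qed.

Lemma mcoeff_mode_basis_l c p q r l a b :
  (constants_mode c (basis_mode c q b r) a << l >>)@_p =
  if (wt p)%:Z == (wt q)%:Z + (wt r)%:Z + (wt l)%:Z - a - b - 2
  then \sum_(s <- level wt ((wt q)%:Z + (wt r)%:Z - b - 1)) c p s l * c s q r
  else 0.
Proof.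
pose F : {linear {malg C[I]} -> {malg C[I]}} := HB.pack
  (fun u => constants_mode c u a << l >>)
  (GRing.isLinear.Build C _ _ *:%R _ (@constants_mode_linear_l c a << l >>)).
rewrite -[constants_mode _ _ _ _]/(F _) [basis_mode c q b r]/basis_mode linear_sum raddf_sum; case: ifPn => h.
  apply: eq_big_seq => s; rewrite (mem_level fin) => /eqP hs.
  rewrite linearZ /= constants_modeU mcoeffZ mcoeff_basis_mode mulrC ifT //; lia.
rewrite big_seq big1 // => s; rewrite (mem_level fin) => /eqP hs.
rewrite linearZ /= constants_modeU mcoeffZ mcoeff_basis_mode ifF ?mulr0 //.
apply/negbTE; lia.
Qed.

Lemma linear_sub_fun (U W : lmodType C) (f g : U -> W) :
  linear f -> linear g -> linear (fun u => f u - g u).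
Proof.
move=> lf lg a u v; rewrite lf lg scalerBr opprD addrACA.
by congr (_ + _).
Qed.

Lemma linear_sum_fun (U W : lmodType C) n (a : 'I_n -> C) (f : 'I_n -> U -> W) :
  (forall j, linear (f j)) -> linear (fun u => \sum_j a j *: f j u).
Proof.
move=> lf b u v; rewrite scaler_sumr -big_split /=; apply: eq_bigr => j _.
by rewrite lf scalerDr !scalerA mulrC.
Qed.

Lemma linear_comp_fun (U V W : lmodType C) (f : V -> W) (g : U -> V) :
  linear f -> linear g -> linear (fun u => f (g u)).
Proof. by move=> lf lg a u v; rewrite lg lf. Qed.

(** Each axiom is linear in its vectors, so it is tested on basis vectors and compared at a basis
    vector [p]. If the weight of [p] does not fit the modes both sides are 0; otherwise the modes
    can be traded for weights. *)
Theorem vertex_algebra_of_constants mu vac c : vertex_constants mu vac c ->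
  is_vertex_algebra (<< vac >> : {malg C[I]}) (constants_mode c).
Proof.
move=> H; pose Y := constants_mode c.
have ll m v : linear (fun u => Y u m v) by exact: constants_mode_linear_l.
have lr u m : linear (Y u m) by exact: constants_mode_linear_r.
have wv := vc_wt_vac H.
have eqlin (f g : {malg C[I]} -> {malg C[I]}) : linear f -> linear g ->
    (forall q, f << q >> = g << q >>) -> forall u, f u = g u.
  move=> lf lg E u; apply/eqP; rewrite -subr_eq0; apply/eqP.
  apply: (linear_malg_eq0 (linear_sub_fun lf lg)) => q _.
  by apply/eqP; rewrite subr_eq0 E.
have lz : linear (fun _ : {malg C[I]} => 0 : {malg C[I]}).
  by move=> a u v; rewrite scaler0 addr0.
split=> //.
(* A nonzero coefficient at [p] forces n = wt q + wt r - wt p - 1, which is below wt q + wt r; the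
   sum dominates this for all pairs in the supports. *)
- move=> u v; exists (\sum_(q <- msupp u) \sum_(r <- msupp v) (wt q + wt r))%N => n hn.
  apply: (linear_malg_eq0 (F := fun u => Y u n v)) => // q qu.
  apply: (linear_malg_eq0 (F := Y << q >> n)) => // r rv.
  rewrite /Y constants_modeU; apply/malgP => p; rewrite mcoeff_basis_mode mcoeff0.
  rewrite ifF //; apply/negbTE/eqP => E.
  have : (wt q + wt r <= \sum_(q <- msupp u) \sum_(r <- msupp v) (wt q + wt r))%N.
    rewrite (big_fsetD1 q) //= (big_fsetD1 r) //=; lia.
  lia.
- move=> n v.
  have -> : (if n == -1 then v else 0) = (if n == -1 then @idfun _ else (fun=> 0)) v.
    by case: ifP.
  apply: eqlin v => // [|r]; first by case: ifP.
  rewrite /Y constants_modeU; apply/malgP => p; rewrite mcoeff_basis_mode.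
  rewrite (vc_vacuum H) wv add0r; case: (eqVneq n (-1)) => [->|n1].
    rewrite mcoeff_basis (eq_sym r); case: (eqVneq p r) => [->|_] /=; last by rewrite if_same.
    by rewrite opprK addrK eqxx.
  rewrite mcoeff0; case: (eqVneq p r) => [->|] //=; last by rewrite if_same.
  by rewrite ifF //; apply/negbTE/eqP => E; lia.
(* Modes n >= -1 applied to the vacuum land in weight wt q - n - 1 <= wt q, exactly the range of
   [vc_creation]. *)
- move=> u; split=> [n n0|].
    apply: (linear_malg_eq0 (F := fun u => Y u n << vac >>)) => // q _.
    rewrite /Y constants_modeU; apply/malgP => p; rewrite mcoeff_basis_mode mcoeff0 wv.
    case: eqP => // E; rewrite (vc_creation H); last by lia.
    by case: eqVneq => // pq; rewrite pq in E; lia.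
  apply: (eqlin (fun u => Y u (-1) << vac >>) idfun) => // q.
  rewrite /Y constants_modeU; apply/malgP => p; rewrite mcoeff_basis_mode wv mcoeff_basis.
  case: eqP => E; last by case: eqVneq => // qp; rewrite qp in E; lia.
  by rewrite (vc_creation H) 1?eq_sym //; lia.
- move=> u n v.
  have lT : linear (fun w => Y w (-2) << vac >>) by [].
  apply: (eqlin (fun u => Y (Y u n v) (-2) << vac >> - Y u n (Y v (-2) << vac >>))
                (fun u => - (n%:~R *: Y u (n - 1) v))) => [||q {u}].
  + exact: (linear_sub_fun (linear_comp_fun lT (ll n v)) (ll n _)).
  + move=> a u1 u2; rewrite ll scalerDr opprD scalerN !scalerA.
    by rewrite (mulrC a).
  apply: (eqlin (fun v => Y (Y << q >> n v) (-2) << vac >> - Y << q >> n (Y v (-2) << vac >>))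
                (fun v => - (n%:~R *: Y << q >> (n - 1) v))) => [||r {v}].
  + exact: (linear_sub_fun (linear_comp_fun lT (lr _ n)) (linear_comp_fun (lr _ n) lT)).
  + move=> a u1 u2; rewrite lr scalerDr opprD scalerN !scalerA.
    by rewrite (mulrC a).
  rewrite /Y !constants_modeU; apply/malgP => p.
  rewrite mcoeffB mcoeffN mcoeffZ mcoeff_mode_basis_l mcoeff_mode_basis_r.
  rewrite mcoeff_basis_mode wv !addr0.
  (* In the surviving case wt p - wt q - wt r = -n, the scalar of the axiom. *)
  case: (eqVneq (wt p)%:Z ((wt q)%:Z + (wt r)%:Z - (n - 1) - 1)) => E; last first.
    rewrite !ifF ?subrr ?mulr0 ?oppr0 //; apply/negbTE; lia.
  rewrite !ifT; try lia.
  have -> : (wt q)%:Z + (wt r)%:Z - n - 1 = (wt p)%:Z - 1 by lia.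
  have -> : (wt r)%:Z - (-2) - 1 = (wt r)%:Z + 1 by lia.
  rewrite /four_point (vc_translation H) -mulNr; congr (_ * _).
  by rewrite -rmorphN; congr (_%:~R); lia.
(* The sum of the orders over both supports dominates each of them, and [local_pairW] raises each
   order to it. *)
- move=> u v; pose M0 := (\sum_(q <- msupp u) \sum_(r <- msupp v) mu q r)%N.
  exists M0 => m n w.
  pose E u v w := \sum_(j < M0.+1) ((-1) ^+ j * 'C(M0, j)%:R) *:
      (Y u (m + M0%:Z - j%:Z) (Y v (n + j%:Z) w) -
       Y v (n + j%:Z) (Y u (m + M0%:Z - j%:Z) w)).
  rewrite -[LHS]/(E u v w).
  apply: (linear_malg_eq0 (F := fun u => E u v w)) => [|q qu].
    apply: linear_sum_fun => j; apply: linear_sub_fun => //.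
    exact: (linear_comp_fun (lr v _) (ll _ w)).
  apply: (linear_malg_eq0 (F := fun v => E << q >> v w)) => [|r rv].
    apply: linear_sum_fun => j; apply: linear_sub_fun => //.
    exact: (linear_comp_fun (lr << q >> _) (ll _ w)).
  apply: (linear_malg_eq0 (F := E << q >> << r >>)) => [|l _].
    by apply: linear_sum_fun => j; apply: linear_sub_fun; apply: linear_comp_fun.
  apply/malgP => p; rewrite mcoeff0 raddf_sum /=.
  under eq_bigr do rewrite /Y mcoeffZ !constants_modeU mcoeffB !mcoeff_mode_basis_r.
  (* The intermediate weight in the term j = 0; the j-th term has weight k0 - j in one ordering and
     D - (k0 - j) in the other, with D = wt p + wt l. *)
  pose k0 := (wt r)%:Z + (wt l)%:Z - n - 1.
  have loc : local_pair M0 (wt p + wt l)%N%:Z (four_point c p q r l) (four_point c p r q l).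
    apply: local_pairW (vc_local H p q r l).
    rewrite /M0 (big_fsetD1 q) //= (big_fsetD1 r) //=; lia.
  case: (eqVneq (wt p)%:Z ((wt q)%:Z + (wt r)%:Z + (wt l)%:Z - m - n - M0%:Z - 2)) => Ep.
    have := loc k0; rewrite !iter_deltaE => /eqP; rewrite -subr_eq0 -sumrB => /eqP E0.
    rewrite -[RHS]E0.
    apply: eq_bigr => j _; rewrite -mulrBr; congr (_ * _).
    rewrite !ifT; try lia.
    congr (_ - _); congr (four_point _ _ _ _ _ _); rewrite /k0; lia.
  rewrite big1 // => j _; rewrite !ifF ?subrr ?mulr0 //; apply/negbTE; lia.
Qed.

End VertexConstants.

(** * The constants of a homogeneous basis *)

Section BasisConstants.
Context (C : numClosedFieldType) (V : unitary_voa C) (Phi : homogeneous_onb V).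
Implicit Types (p q r s l : elt Phi) (v w : V).
Local Notation form := (@Defs.form C V).

Let voaP := uv_voa V.
Let vaP := voa_va voaP.
Let unitP := uv_unitary V.

Lemma form_sumZ (J : Type) (t : seq J) (a : J -> C) (F : J -> V) v :
  form v (\sum_(j <- t) a j *: F j) = \sum_(j <- t) a j * form v (F j).
Proof.
have F0 : form v 0 = 0.
  by have := form_linear unitP v (-1) 0 0; rewrite scaler0 addr0 mulN1r addNr.
elim: t => [|j t IH]; first by rewrite !big_nil.
by rewrite !big_cons (form_linear unitP) IH.
Qed.

Lemma formB v w1 w2 : form v (w1 - w2) = form v w1 - form v w2.
Proof.
by rewrite -mulN1r [RHS]addrC -(form_linear unitP) scaleN1r addrC.
Qed.

Lemma form0 v : form v 0 = 0.
Proof. by rewrite -(subrr 0) formB subrr. Qed.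

Lemma mode_sumZ (J : Type) (t : seq J) (a : J -> C) (F : J -> V) v n :
  mode v n (\sum_(j <- t) a j *: F j) = \sum_(j <- t) a j *: mode v n (F j).
Proof.
have lin := va_linear_r vaP v n.
have F0 : mode v n 0 = 0.
  by have := lin (-1) 0 0; rewrite scaler0 addr0 scaleN1r addNr.
elim: t => [|j t IH]; first by rewrite !big_nil.
by rewrite !big_cons lin IH.
Qed.

Lemma mode_sumZl (J : Type) (t : seq J) (a : J -> C) (F : J -> V) v n :
  mode (\sum_(j <- t) a j *: F j) n v = \sum_(j <- t) a j *: mode (F j) n v.
Proof.
have lin := va_linear_l vaP n v.
have F0 : mode 0 n v = 0.
  by have := lin (-1) 0 0; rewrite scaler0 addr0 scaleN1r addNr.
elim: t => [|j t IH]; first by rewrite !big_nil.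
by rewrite !big_cons lin IH.
Qed.

Lemma elt_weight p : weight_space (@mode C V) (conformal V) (elt_wt p) (elt_val p).
Proof. exact: (onb_weight (valP (tagged p))). Qed.

(** A basis vector has norm 1, hence is nonzero, and its eigenvalue under L(0) recovers the weight
    tag. *)
Lemma elt_val_inj : injective (@elt_val C V Phi).
Proof.
move=> [n u] [m v] E.
have un := onb_weight (valP u); have vm := onb_weight (valP v).
have nz : val u != 0.
  apply/eqP => u0; have := onb_orthonormal (valP u) (valP u).
  by rewrite u0 form0 eqxx => /eqP; rewrite eq_sym oner_eq0.
have nm : n = m.
  apply/eqP; move: un vm; rewrite /elt_val /= in E.
  rewrite /weight_space /= -E => -> /eqP; rewrite -subr_eq0 -scalerBl scaler_eq0.
  by rewrite (negbTE nz) orbF subr_eq0 eqr_nat.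
case: _ / nm in v E vm *.
by congr (Tagged _ _); apply: val_inj.
Qed.

Lemma form_elt p q : form (elt_val p) (elt_val q) = (p == q)%:R.
Proof.
rewrite (onb_orthonormal (valP (tagged p)) (valP (tagged q))).
by rewrite -(inj_eq elt_val_inj).
Qed.

Lemma finite_levels_elt : finite_levels (@elt_wt C V Phi).
Proof.
move=> n; apply: (@sub_finite_set _ _ ((fun u : Phi n => Tagged (fun n => Phi n) u) @` setT)).
  by move=> [m u] /= mn; case: _ / mn in u *; exists u.
exact: finite_image finite_finset.
Qed.

Lemma elt_val_vac : elt_val (elt_vac Phi) = vacuum V.
Proof. by []. Qed.

Lemma elt_wt_eq0 p : elt_wt p = 0%N -> p = elt_vac Phi.
Proof.
move=> p0; apply: elt_val_inj; rewrite elt_val_vac; case: p p0 => n u /= n0.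
case: _ / (esym n0) in u *.
suff : val u \in [fset vacuum V]%fset by rewrite inE => /eqP.
by rewrite -(onb_vacuum Phi); exact: (valP u).
Qed.

(** Allowing every larger [D'] lets the expansion be compared with sums over other finite sets, such
    as levels. *)
Lemma elt_expansion v : exists D : {fset elt Phi}, forall D' : {fset elt Phi},
  (D `<=` D')%fset -> v = \sum_(p <- D') form (elt_val p) v *: elt_val p.
Proof.
have [s [a [sP vE]]] := onb_span Phi v.
have [ix ixE] : {ix : V -> elt Phi & forall u, u \in s -> elt_val (ix u) = u}.
  apply: (@choice _ _ (fun u p => u \in s -> elt_val p = u)) => u.
  have [us|us] := boolP (u \in s); last by exists (elt_vac Phi).
  by have [n un] := sP _ us; exists (Tagged (fun n => Phi n) [` un]%fset).
have {vE} vE : v = \sum_(u <- s) a u *: elt_val (ix u).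
  by rewrite vE; apply: eq_big_seq => u us; rewrite ixE.
exists [fset ix u | u in s]%fset => D' /fsubsetP DD'.
under eq_bigr do rewrite {1}vE form_sumZ scaler_suml.
rewrite exchange_big /= {1}vE; apply: eq_big_seq => u us.
have pD : ix u \in D' by apply: DD'; apply/imfsetP; exists u.
rewrite (big_fsetD1 (ix u)) //= form_elt eqxx mulr1 big_seq big1 ?addr0 // => p.
by rewrite !inE => /andP[/negbTE pu _]; rewrite form_elt pu mulr0 scale0r.
Qed.

Lemma level_expansion v (k : int) :
  (forall p, form (elt_val p) v != 0 -> (elt_wt p)%:Z = k) ->
  v = \sum_(p <- level (@elt_wt C V Phi) k) form (elt_val p) v *: elt_val p.
Proof.
move=> vk; have [D vD] := elt_expansion v.
rewrite {1}(vD (D `|` level (@elt_wt C V Phi) k)%fset); last exact: fsubsetUl.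
apply/esym/big_fset_incl; first exact: fsubsetUr.
move=> p _ hp; apply/eqP; rewrite scaler_eq0; apply/orP; left.
by apply: contraNT hp => /vk pk; rewrite (mem_level finite_levels_elt) pk.
Qed.

(** L(0) is diagonal in the basis, so after expanding [v] the pairing with [p] picks out the
    eigenvalue of [p]. *)
Lemma form_L0 p v : form (elt_val p) (virasoro (@mode C V) (conformal V) 0 v) =
  (elt_wt p)%:R * form (elt_val p) v.
Proof.
have [D vD] := elt_expansion v.
pose E := (D `|` [fset p])%fset.
rewrite (vD E); last exact: fsubsetUl.
rewrite /virasoro mode_sumZ !form_sumZ mulr_sumr; apply: eq_bigr => q _.
have := elt_weight q; rewrite /weight_space /= /virasoro => ->.
(* A one-term instance of [form_sumZ] serves as homogeneity of the form. *)
have := form_sumZ [:: tt] (fun=> (elt_wt q)%:R) (fun=> elt_val q) (elt_val p).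
rewrite !big_seq1 => ->; rewrite form_elt mulrCA.
by case: eqVneq => [->|_]; rewrite ?mulr0.
Qed.

(** The product is an eigenvector of L(0), with eigenvalue given by [voa_mode_weight]; a nonzero
    pairing with [p] identifies it with the weight of [p], as distinct integers stay distinct in
    [C]. *)
Lemma form_mode_weight p q n r : form (elt_val p) (mode (elt_val q) n (elt_val r)) != 0 ->
  (elt_wt p)%:Z = (elt_wt q)%:Z + (elt_wt r)%:Z - n - 1.
Proof.
move=> nz; have := voa_mode_weight voaP n (elt_weight q) (elt_weight r).
move=> /(congr1 (form (elt_val p))); rewrite form_L0.
set k := (_ - 1 : int); have := form_sumZ [:: tt] (fun=> k%:~R)
  (fun=> mode (elt_val q) n (elt_val r)) (elt_val p).
rewrite !big_seq1 => -> /(mulIf nz) /eqP.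
by rewrite -[_%:R]/((elt_wt p)%:Z%:~R) eqr_int => /eqP.
Qed.

Definition basis_const p q r : C :=
  form (elt_val p) (mode (elt_val q)
    ((elt_wt q)%:Z + (elt_wt r)%:Z - (elt_wt p)%:Z - 1) (elt_val r)).

Lemma form_modeE p q n r : form (elt_val p) (mode (elt_val q) n (elt_val r)) =
  if (elt_wt p)%:Z == (elt_wt q)%:Z + (elt_wt r)%:Z - n - 1 then basis_const p q r else 0.
Proof.
case: eqP => [E|nE]; first by rewrite /basis_const; congr (form _ (mode _ _ _)); lia.
by apply/eqP; apply: contra_notT nE => /form_mode_weight.
Qed.

Lemma mode_expansion q n r : mode (elt_val q) n (elt_val r) =
  \sum_(p <- level (@elt_wt C V Phi) ((elt_wt q)%:Z + (elt_wt r)%:Z - n - 1))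
    basis_const p q r *: elt_val p.
Proof.
rewrite [LHS](@level_expansion _ _ (fun p => @form_mode_weight p q n r)).
apply: eq_big_seq => p; rewrite (mem_level finite_levels_elt) => hp.
by rewrite form_modeE hp.
Qed.

Lemma form_mode_mode p q r l a b :
  form (elt_val p) (mode (elt_val q) a (mode (elt_val r) b (elt_val l))) =
  if (elt_wt p)%:Z == (elt_wt q)%:Z + (elt_wt r)%:Z + (elt_wt l)%:Z - a - b - 2
  then four_point (@elt_wt C V Phi) basis_const p q r l
         ((elt_wt r)%:Z + (elt_wt l)%:Z - b - 1)
  else 0.
Proof.
rewrite mode_expansion mode_sumZ form_sumZ /four_point; case: ifPn => h.
  apply: eq_big_seq => s; rewrite (mem_level finite_levels_elt) => /eqP hs.
  rewrite form_modeE ifT 1?mulrC //; lia.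
rewrite big_seq big1 // => s; rewrite (mem_level finite_levels_elt) => /eqP hs.
rewrite form_modeE ifF ?mulr0 //; apply/negbTE; lia.
Qed.

Lemma form_mode_of_mode p q r l a b :
  form (elt_val p) (mode (mode (elt_val q) b (elt_val r)) a (elt_val l)) =
  if (elt_wt p)%:Z == (elt_wt q)%:Z + (elt_wt r)%:Z + (elt_wt l)%:Z - a - b - 2
  then \sum_(s <- level (@elt_wt C V Phi) ((elt_wt q)%:Z + (elt_wt r)%:Z - b - 1))
         basis_const p s l * basis_const s q r
  else 0.
Proof.
rewrite mode_expansion mode_sumZl form_sumZ; case: ifPn => h.
  apply: eq_big_seq => s; rewrite (mem_level finite_levels_elt) => /eqP hs.
  rewrite form_modeE ifT 1?mulrC //; lia.
rewrite big_seq big1 // => s; rewrite (mem_level finite_levels_elt) => /eqP hs.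
rewrite form_modeE ifF ?mulr0 //; apply/negbTE; lia.
Qed.

(** Picked by choice, because the orders have to be a function of the pair in order to be summed. *)
Definition basis_local_order q r : nat :=
  sval (cid (va_locality vaP (elt_val q) (elt_val r))).

Theorem basis_constants :
  vertex_constants (@elt_wt C V Phi) basis_local_order (elt_vac Phi) basis_const.
Proof.
have w0 : elt_wt (elt_vac Phi) = 0%N by [].
split=> //.
- move=> p r; rewrite /basis_const elt_val_vac w0 (va_vacuum vaP).
  case: eqP => E; first exact: form_elt.
  by rewrite form0; case: eqVneq => // pr; case: E; rewrite pr; lia.
- move=> p q pq; rewrite /basis_const elt_val_vac w0.
  have [h0 h1] := va_creation vaP (elt_val q).
  case: (eqVneq (elt_wt p) (elt_wt q)) => E.
    have -> : (elt_wt q)%:Z + 0%N%:Z - (elt_wt p)%:Z - 1 = -1 by lia.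
    by rewrite h1 form_elt.
  rewrite h0 ?form0; last by lia.
  by case: eqVneq => // pq'; rewrite pq' eqxx in E.
- move=> p q r.
  (* Chosen so that n - 1 is the mode index occurring in [basis_const p q r]. *)
  pose n := (elt_wt q)%:Z + (elt_wt r)%:Z - (elt_wt p)%:Z.
  have := congr1 (form (elt_val p)) (va_translation vaP (elt_val q) n (elt_val r)).
  rewrite formB -elt_val_vac form_mode_of_mode form_mode_mode !ifT ?w0 /n; try lia.
  have -> : (elt_wt q)%:Z + (elt_wt r)%:Z - n - 1 = (elt_wt p)%:Z - 1 by rewrite /n; lia.
  have -> : (elt_wt r)%:Z + 0%N%:Z - (-2) - 1 = (elt_wt r)%:Z + 1 by lia.
  rewrite /four_point => ->.
  have := form_sumZ [:: tt] (fun=> - n%:~R)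
    (fun=> mode (elt_val q) (n - 1) (elt_val r)) (elt_val p).
  rewrite !big_seq1 scaleNr => ->; rewrite form_modeE ifT; last by rewrite /n; lia.
  by congr (_ * _); rewrite -rmorphN; congr (_%:~R); rewrite /n; lia.
- move=> p q r l k; rewrite /basis_local_order; case: cid => M /= loc.
  (* Modes for which the inner product of the j-th term has weight k - j in the first ordering and
     the total weight is that of [p]. *)
  have := loc ((elt_wt q)%:Z - (elt_wt p)%:Z - M%:Z - 1 + k)
    ((elt_wt r)%:Z + (elt_wt l)%:Z - k - 1) (elt_val l).
  move=> /(congr1 (form (elt_val p))); rewrite form_sumZ form0.
  move=> E0; apply/eqP; rewrite -subr_eq0 !iter_deltaE -sumrB -[X in _ == X]E0.
  apply/eqP/eq_bigr => j _; rewrite -mulrBr; congr (_ * _).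
  rewrite formB !form_mode_mode !ifT; try lia.
  congr (_ - _); congr (four_point _ _ _ _ _ _); lia.
Qed.

End BasisConstants.

(** * Tensor powers *)

Lemma finite_set_ffun_in (X : finType) (I : choiceType) (D : {fset I}) :
  finite_set [set g : {ffun X -> I} | forall x, g x \in D].
Proof.
pose incl (f : {ffun X -> D}) : {ffun X -> I} := [ffun x => val (f x)].
apply: (@sub_finite_set _ _ (incl @` setT)); last exact: finite_image finite_finset.
move=> g gD; exists [ffun x => FSetSub (gD x)] => //.
by apply/ffunP => x; rewrite !ffunE.
Qed.

Section TensorConstants.
Context (C : numClosedFieldType) (I : choiceType) (wt : I -> nat).
Context (mu : I -> I -> nat) (vac : I) (c : I -> I -> I -> C).
Hypothesis fin : finite_levels wt.
Hypothesis Hc : vertex_constants wt mu vac c.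
Hypothesis wt_eq0 : forall p, wt p = 0%N -> p = vac.

(** Functions of total weight below [L] take values here, and functions into this set form a finite
    type, over which products of sums can be expanded. *)
Definition below (L : nat) : {fset I} := fset_set [set i | (wt i < L)%N].

Lemma mem_below L i : (i \in below L) = (wt i < L)%N.
Proof.
rewrite in_fset_set; first by apply/idP/idP; rewrite inE.
rewrite (_ : [set i | _] = \bigcup_(k in `I_L) [set i | wt i = k]).
  by apply: bigcup_finite => [|k _]; [exact: finite_II | exact: fin].
apply/seteqP; split => [j jL | j [k kL /= ->]] //=; by exists (wt j).
Qed.

Section FixedSet.
Context (X : finType).
Implicit Types (p q r s l : {ffun X -> I}).

Definition twt p : nat := (\sum_x wt (p x))%N.
Definition tconst p q r : C := \prod_x c (p x) (q x) (r x).
Definition tvac : {ffun X -> I} := [ffun=> vac].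

Let incl L (f : {ffun X -> below L}) : {ffun X -> I} := [ffun x => val (f x)].

Let incl_inj L : injective (@incl L).
Proof.
move=> f g /ffunP E; apply/ffunP => x; apply: val_inj.
by have := E x; rewrite !ffunE.
Qed.

Let incl_surj L s : (forall x, (wt (s x) < L)%N) -> exists f : {ffun X -> below L}, s = incl f.
Proof.
move=> sL; have sD x : s x \in below L by rewrite mem_below.
exists [ffun x => FSetSub (sD x)].
by apply/ffunP => x; rewrite !ffunE.
Qed.

Let wt_le_twt s x : (wt (s x) <= twt s)%N.
Proof. by rewrite /twt (bigD1 x) //= leq_addr. Qed.

Lemma finite_levels_twt : finite_levels twt.
Proof.
move=> n; apply: sub_finite_set (@finite_set_ffun_in X I (below n.+1)).
by move=> s /= <- x; rewrite mem_below ltnS wt_le_twt.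
Qed.

(** Expanding the product of the one-site generating functions, [s] contributes the monomial of
    degree [twt s]. No site of an [s] of weight [k] exceeds [k], so truncation at [L > k] loses
    nothing. *)
Lemma level_twt_sum (F : X -> I -> C) L (k : nat) : (k < L)%N ->
  \sum_(s <- level twt k%:Z) \prod_x F x (s x) =
  (\prod_x truncation L (fun j => \sum_(i <- level wt j) F x i))`_k.
Proof.
move=> kL.
have tr x : truncation L (fun j => \sum_(i <- level wt j) F x i) =
    \sum_(i : below L) F x (val i) *: 'X^(wt (val i)).
  apply/polyP => j; rewrite coef_poly coef_sum.
  under [in RHS]eq_bigr do rewrite coefZ coefXn mulr_natr mulrb.
  rewrite -(big_seq_fsetE _ (below L) xpredT (fun i => if j == wt i then F x i else 0)) /=.
  rewrite -big_mkcond /= -[in RHS]big_filter; case: ltnP => jL.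
    apply: perm_big; apply: uniq_perm; rewrite ?filter_uniq ?fset_uniq // => i.
    rewrite mem_filter mem_below (mem_level fin) eqz_nat eq_sym.
    by case: eqP => //= <-; rewrite jL.
  rewrite big_seq big1 // => i; rewrite mem_filter mem_below => /andP[/eqP <-].
  by rewrite ltnNge jL.
under [in RHS]eq_bigr do rewrite tr.
rewrite bigA_distr_bigA coef_sum /=.
under [in RHS]eq_bigr do rewrite scaler_prod -expr_sum coefZ coefXn mulr_natr mulrb.
rewrite -big_mkcond /=.
have -> : \sum_(f : {ffun X -> below L} | k == (\sum_x wt (val (f x)))%N) \prod_x F x (val (f x)) =
    \sum_(s <- [seq incl f | f <- enum {ffun X -> below L}] | k == twt s) \prod_x F x (s x).
  rewrite big_map big_enum_cond /=; apply: eq_big => f; rewrite ?/twt.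
    by congr (_ == _); apply: eq_bigr => x _; rewrite ffunE.
  by move=> _; apply: eq_bigr => x _; rewrite ffunE.
rewrite -[RHS]big_filter; apply: perm_big; apply: uniq_perm; rewrite ?fset_uniq //.
  by rewrite filter_uniq // map_inj_uniq ?enum_uniq //; exact: incl_inj.
move=> s; rewrite mem_filter (mem_level finite_levels_twt) eqz_nat eq_sym.
case: eqP => //= ks; apply/esym/mapP.
have [x|f ->] := @incl_surj L s; last by exists f; rewrite ?mem_enum.
by apply: leq_ltn_trans kL; rewrite ks.
Qed.

Lemma tconst_vacuum p r : tconst p tvac r = (p == r)%:R.
Proof.
rewrite /tconst; under eq_bigr do rewrite ffunE (vc_vacuum Hc).
case: (eqVneq p r) => [->|pr].
  by rewrite big1 // => x _; rewrite eqxx.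
have /existsP[x px] : [exists x, p x != r x].
  rewrite -negb_forall; apply: contra pr => /forallP E.
  by apply/eqP/ffunP => x; apply/eqP.
by rewrite (bigD1 x) //= (negbTE px) mul0r.
Qed.

(** If p and q differ, some site has p x != q x and wt (p x) <= wt (q x), which kills the product;
    otherwise every differing site would make p heavier. *)
Lemma tconst_creation p q : (twt p <= twt q)%N -> tconst p q tvac = (p == q)%:R.
Proof.
move=> pq; rewrite /tconst; under eq_bigr do rewrite ffunE.
case: (eqVneq p q) => [->|npq].
  by rewrite big1 // => x _; rewrite (vc_creation Hc) ?eqxx.
suff [x xlt] : exists x, (wt (p x) <= wt (q x))%N && (p x != q x).
  move: xlt => /andP[h1 h2].
  by rewrite (bigD1 x) //= (vc_creation Hc) // (negbTE h2) mul0r.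
apply/existsP; apply: contraNT npq; rewrite negb_exists => /forallP h.
have h' x : (wt (q x) <= wt (p x))%N.
  have := h x; rewrite negb_and -ltnNge negbK => /orP[/ltnW //|/eqP -> //].
apply/eqP/ffunP => x; have := h x; rewrite negb_and negbK => /orP[|/eqP //].
rewrite -ltnNge => hx; exfalso.
move: pq; rewrite /twt leqNgt => /negP; apply.
rewrite (bigD1 x) //= [X in (_ < X)%N](bigD1 x) //= -addSn.
by apply: leq_add => //; apply: leq_sum.
Qed.

(** A Leibniz rule: the coefficient of X is a derivation over the constant term, and P x and Q x
    share the constant term a x. *)
Lemma coef01_prod (P Q : X -> {poly C}) (a : X -> C) (n : X -> int) :
  (forall x, (P x)`_0 = a x) -> (forall x, (Q x)`_0 = a x) ->
  (forall x, (P x)`_1 - (Q x)`_1 = (n x)%:~R * a x) ->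
  (\prod_x P x)`_1 - (\prod_x Q x)`_1 = (\sum_x n x)%:~R * \prod_x a x.
Proof.
move=> P0 Q0 PQ1.
suff [] : [/\ (\prod_x P x)`_0 = \prod_x a x, (\prod_x Q x)`_0 = \prod_x a x &
   (\prod_x P x)`_1 - (\prod_x Q x)`_1 = (\sum_x n x)%:~R * \prod_x a x] by [].
elim: (index_enum X) => [|x r [IP IQ IPQ]].
  by rewrite !big_nil !coef1 subrr mul0r.
rewrite !big_cons !coef0M IP IQ P0 Q0; split=> //.
rewrite !coefM !big_ord_recl !big_ord0 /= /bump /= !addn0 !subn0 subnn.
rewrite IP IQ P0 Q0 !addr0 rmorphD /=.
transitivity (a x * ((\prod_(j <- r) P j)`_1 - (\prod_(j <- r) Q j)`_1) +
  ((P x)`_1 - (Q x)`_1) * \prod_(j <- r) a j); first by ring.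
by rewrite IPQ PQ1; ring.
Qed.

(** T is a derivation of the tensor product. At each site the first sum has top coefficient c(p; q,
    r) and the second has the same bottom coefficient; [vc_translation] compares the coefficients
    next to these. [P] reads the first from the top and [Q] the second from the bottom, which leads
    to [coef01_prod]. *)
Lemma tconst_translation p q r :
  \sum_(s <- level twt ((twt p)%:Z - 1)) tconst p s tvac * tconst s q r -
  \sum_(s <- level twt ((twt r)%:Z + 1)) tconst p q s * tconst s r tvac =
  ((twt p)%:Z - (twt q)%:Z - (twt r)%:Z)%:~R * tconst p q r.
Proof.
(* Large enough to exceed both [twt p] and the level [twt r + 1]. *)
pose L := (twt p + twt r).+2.
pose A x (j : int) := \sum_(i <- level wt j) c (p x) i vac * c i (q x) (r x).
pose B x (j : int) := \sum_(i <- level wt j) c (p x) (q x) i * c i (r x) vac.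
have Atop x (j : int) : (wt (p x))%:Z <= j ->
    A x j = if j == (wt (p x))%:Z then c (p x) (q x) (r x) else 0.
  move=> pj; rewrite /A; have E (i : I) : i \in level wt j ->
     c (p x) i vac * c i (q x) (r x) = if i == p x then c (p x) (q x) (r x) else 0.
    rewrite (mem_level fin) => /eqP ij; rewrite (vc_creation Hc); last by lia.
    by rewrite eq_sym; case: eqVneq => [->|]; rewrite ?mul1r ?mul0r.
  rewrite (eq_big_seq _ E) -big_mkcond /=.
  case: (eqVneq j (wt (p x))%:Z) => [->|nj].
    by rewrite -big_filter filter_pred1_uniq ?fset_uniq ?big_seq1 ?(mem_level fin).
  rewrite big_seq_cond big1 // => i; rewrite (mem_level fin) => /andP[/eqP E1 /eqP E2].
  by move: nj; rewrite -E1 E2 eqxx.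
have Bbot x (j : int) : j <= (wt (r x))%:Z ->
    B x j = if j == (wt (r x))%:Z then c (p x) (q x) (r x) else 0.
  move=> pj; rewrite /B; have E (i : I) : i \in level wt j ->
     c (p x) (q x) i * c i (r x) vac = if i == r x then c (p x) (q x) (r x) else 0.
    rewrite (mem_level fin) => /eqP ij; rewrite (vc_creation Hc); last by lia.
    by case: eqVneq => [->|]; rewrite ?mulr1 ?mulr0.
  rewrite (eq_big_seq _ E) -big_mkcond /=.
  case: (eqVneq j (wt (r x))%:Z) => [->|nj].
    by rewrite -big_filter filter_pred1_uniq ?fset_uniq ?big_seq1 ?(mem_level fin).
  rewrite big_seq_cond big1 // => i; rewrite (mem_level fin) => /andP[/eqP E1 /eqP E2].
  by move: nj; rewrite -E1 E2 eqxx.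
pose P x := rev_poly (wt (p x)) (truncation L (A x)).
pose Q x := \poly_(j < L) B x ((wt (r x))%:Z + j%:Z).
have sA x : (size (truncation L (A x)) <= (wt (p x)).+1)%N.
  apply/leq_sizeP => j hj; rewrite coef_poly; case: ifP => // _.
  rewrite Atop; last by lia.
  by rewrite ifF //; apply/negbTE; lia.
have [sAA revA] := rev_poly_prod sA.
have wL x : (wt (p x) < L)%N by have := wt_le_twt p x; rewrite /L; lia.
have SA : \sum_(s <- level twt ((twt p)%:Z - 1)) tconst p s tvac * tconst s q r =
    (\prod_x P x)`_1.
  rewrite -revA coef_poly -/(twt p); case: (posnP (twt p)) => [->|p0].
    by rewrite sub0r (sum_level_neg finite_levels_twt).
  rewrite ifT; last by lia.
  have -> : (twt p)%:Z - 1 = (twt p - 1)%N%:Z by lia.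
  rewrite -(level_twt_sum (fun x i => c (p x) i vac * c i (q x) (r x))); last by lia.
  apply: eq_bigr => s _; rewrite -big_split /=; apply: eq_bigr => x _.
  by rewrite ffunE.
have QE x : eq_upto L (truncation L (B x)) ('X^(wt (r x)) * Q x).
  move=> j jL; rewrite coefXnM coef_poly jL; case: ltnP => jr.
    by rewrite Bbot; [rewrite ifF //; apply/negbTE; lia | lia].
  by rewrite coef_poly ifT; [congr (B x _) |]; lia.
have SB : \sum_(s <- level twt ((twt r)%:Z + 1)) tconst p q s * tconst s r tvac =
    (\prod_x Q x)`_1.
  have -> : (twt r)%:Z + 1 = (twt r).+1%:Z by lia.
  transitivity (\prod_x truncation L (B x))`_(twt r).+1.
    rewrite -(level_twt_sum (fun x i => c (p x) (q x) i * c i (r x) vac)); last first.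
      by rewrite /L; lia.
    apply: eq_bigr => s _; rewrite -big_split /=; apply: eq_bigr => x _.
    by rewrite ffunE.
  rewrite (eq_upto_prod QE); last by rewrite /L; lia.
  by rewrite big_split /= -expr_sum coefXnM -/(twt r) ltnNge leqnSn /= subSn // subnn.
rewrite SA SB; have -> : (twt p)%:Z - (twt q)%:Z - (twt r)%:Z =
    \sum_x ((wt (p x))%:Z - (wt (q x))%:Z - (wt (r x))%:Z).
  by rewrite !sumrB /twt !(big_morph Posz PoszD (erefl 0)).
apply: coef01_prod => x.
- by rewrite coef_poly /= subn0 coef_poly wL Atop ?eqxx.
- by rewrite coef_poly /= addr0 Bbot ?eqxx.
- rewrite -(vc_translation Hc) !coef_poly; congr (_ - _).
  (* At a site of weight 0 the reversed polynomial has no coefficient 1, in agreement with the empty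
     level -1. *)
  case: (ltnP 1 (wt (p x)).+1) => hp; last first.
    by rewrite (sum_level_neg fin) //; lia.
  by rewrite ifT; [congr (A x _) | have := wL x]; lia.
Qed.

(** At most m sites carry a non-vacuum value of a function of weight m, and the double sum bounds
    the order at each of them; the number of sites does not enter. *)
Definition tlocal_order (m n : nat) : nat :=
  (m * \sum_(a <- below m.+1) \sum_(b <- below n.+1) mu a b)%N.

Lemma tconst_local p q r l :
  local_pair (tlocal_order (twt q) (twt r)) (twt p + twt l)%N%:Z
    (four_point twt tconst p q r l) (four_point twt tconst p r q l).
Proof.
pose K := (\sum_(a <- below (twt q).+1) \sum_(b <- below (twt r).+1) mu a b)%N.
(* Order 0 at vacuum sites; every other site has weight at least 1 by [wt_eq0], so the weight of q
   pays for its order. *)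
pose M x := if q x == vac then 0%N else mu (q x) (r x).
have MK x : (M x <= wt (q x) * K)%N.
  rewrite /M; case: eqP => // qv.
  have q0 : (0 < wt (q x))%N.
    by rewrite lt0n; apply/eqP => /wt_eq0.
  have qin : q x \in below (twt q).+1 by rewrite mem_below ltnS wt_le_twt.
  have rin : r x \in below (twt r).+1 by rewrite mem_below ltnS wt_le_twt.
  apply: leq_trans (leq_pmull _ q0).
  by rewrite /K (big_fsetD1 (q x)) //= (big_fsetD1 (r x)) //= -addnA leq_addr.
apply: (@local_pairW _ (\sum_x M x)).
  by rewrite /tlocal_order -/K /twt big_distrl; apply: leq_sum => x _.
have -> : (twt p + twt l = \sum_x (wt (p x) + wt (l x)))%N by rewrite big_split.
have four q' r' L (k : nat) : (k < L)%N -> four_point twt tconst p q' r' l k%:Z =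
    (\prod_x truncation L (four_point wt c (p x) (q' x) (r' x) (l x)))`_k.
  move=> kL; rewrite -(level_twt_sum (fun x i => c (p x) (q' x) i * c i (r' x) (l x))) //.
  by apply: eq_bigr => s _; rewrite -big_split.
apply: (local_pair_prod (D := fun x => (wt (p x) + wt (l x))%N)
  (A := fun x => four_point wt c (p x) (q x) (r x) (l x))
  (B := fun x => four_point wt c (p x) (r x) (q x) (l x))) => //; last first.
  move=> x; rewrite /M; case: eqP => [-> k /=|_]; last exact: (vc_local Hc).
  (* With the vacuum inserted, the only intermediate state is [p x] in one ordering and [l x] in the
     other; their weights add up to D. *)
  rewrite /four_point.
  under eq_bigr do rewrite (vc_vacuum Hc) mulrC mulr_natr mulrb eq_sym.
  under [in RHS]eq_bigr do rewrite (vc_vacuum Hc) mulr_natr mulrb.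
  rewrite -!big_mkcond /= -[LHS]big_filter -[RHS]big_filter.
  have E j y : [seq i <- level wt j | i == y] = if (wt y)%:Z == j then [:: y] else [::].
    case: ifP; rewrite -(mem_level fin) => hy; first by rewrite filter_pred1_uniq ?fset_uniq.
    apply/eqP; rewrite -[_ == _]negbK -has_filter.
    by apply/hasPn => i hi /=; apply: contraFN hy => /eqP <-.
  rewrite !E; have -> : ((wt (l x))%:Z == (wt (p x) + wt (l x))%N%:Z - k) = ((wt (p x))%:Z == k).
    by apply/eqP/eqP; lia.
  by case: ifP; rewrite ?big_nil ?big_seq1.
all: first [exact: four | move=> *; rewrite /four_point sum_level_neg //].
all: first [exact: fin | exact: finite_levels_twt].
Qed.

Theorem tensor_constants : vertex_constants twt
  (fun q r => tlocal_order (twt q) (twt r)) tvac tconst.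
Proof.
split; [|exact: tconst_vacuum|exact: tconst_creation|exact: tconst_translation|exact: tconst_local].
by rewrite /twt big1 // => x _; rewrite ffunE (vc_wt_vac Hc).
Qed.

End FixedSet.
End TensorConstants.

(** * Orbit sums *)

Section Orbits.
Context (C : numClosedFieldType) (J : choiceType) (wt : J -> nat).
Context (gT : finGroupType) (G : {group gT}) (act : gT -> J -> J).
Hypothesis fin : finite_levels wt.
Hypothesis actM : forall s t g, act s (act t g) = act (t * s)%g g.
Hypothesis act1 : forall g, act 1%g g = g.
Hypothesis wt_act : forall s g, wt (act s g) = wt g.
Implicit Types (g h p q r l : J).

Definition gsum (F : J -> C) g : C := \sum_(s in G) F (act s g).

Definition stab_card g : nat := #|[set s in G | act s g == g]%SET|.

(** The group sum paired with itself counts pairs s, t in G with the same effect on g, namely |G|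
    times the order of the stabilizer. *)
Definition orbit_norm g : C := (sqrtC (#|G| * stab_card g)%:R)^-1.

Lemma gsum_act (F : J -> C) u g : u \in G -> gsum (F \o act u) g = gsum F g.
Proof.
move=> uG; rewrite /gsum [RHS](reindex_inj (mulIg u)) /=.
by apply: eq_big => s; [rewrite groupMr | rewrite actM].
Qed.

Lemma eq_gsum (F F' : J -> C) g : F =1 F' -> gsum F g = gsum F' g.
Proof. by move=> FF; apply: eq_bigr. Qed.

Lemma exchange_gsum (F : J -> J -> C) g h :
  gsum (fun g => gsum (F g) h) g = gsum (fun h => gsum (F^~ h) g) h.
Proof. exact: exchange_big. Qed.

Lemma gsumZ a (F : J -> C) g : a * gsum F g = gsum (fun h => a * F h) g.
Proof. exact: mulr_sumr. Qed.

Lemma stab_card_gt0 g : (0 < stab_card g)%N.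
Proof. by apply/card_gt0P; exists 1%g; rewrite inE group1 act1 eqxx. Qed.

Lemma orbit_norm_sqr g : orbit_norm g * orbit_norm g = (#|G| * stab_card g)%:R^-1.
Proof. by rewrite -invfM -expr2 sqrtCK. Qed.

Lemma card_transporter g h u : u \in G -> act u g = h ->
  #|[set s in G | act s g == h]%SET| = stab_card g.
Proof.
move=> uG <-; rewrite /stab_card -[RHS](card_imset _ (mulIg u)).
apply: eq_card => s; rewrite inE; apply/andP/imsetP => [[sG /eqP E]|[t]].
  exists (s * u^-1)%g; last by rewrite mulgKV.
  by rewrite inE groupM ?groupV //= -actM E actM mulgV act1.
by rewrite inE => /andP[tG /eqP E] ->; rewrite groupM // -actM E eqxx.
Qed.

(** The labels [T] are kept apart from the functions [J], so that the same labels can serve every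
    N. *)
Record representatives (T : choiceType) (r : seq T) (e : T -> J) (k : int) : Prop :=
  Representatives {
  rep_uniq : uniq r;
  rep_wt : forall i, i \in r -> (wt (e i))%:Z = k;
  rep_surj : forall h, (wt h)%:Z = k ->
    exists2 i, i \in r & exists2 s, s \in G & act s (e i) = h;
  rep_inj : forall i j s, i \in r -> j \in r -> s \in G ->
    act s (e i) = e j -> i = j
}.

Section Representatives.
Context (T : choiceType) (r : seq T) (e : T -> J) (k : int).
Hypothesis Hr : representatives r e k.

(** The inverse squared norms turn a sum over representatives into a sum over
    the whole level. *)
Lemma sum_representatives (H K : J -> C) :
  (forall s g, s \in G -> H (act s g) = H g) ->
  (forall s g, s \in G -> K (act s g) = K g) ->
  \sum_(i <- r) (orbit_norm (e i) * gsum H (e i)) * (orbit_norm (e i) * gsum K (e i)) =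
  \sum_(h <- level wt k) H h * K h.
Proof.
move=> HG KG; pose F h := H h * K h.
have cst (H' : J -> C) g : (forall s g, s \in G -> H' (act s g) = H' g) ->
    gsum H' g = #|G|%:R * H' g.
  move=> H'G; rewrite /gsum (eq_bigr (fun=> H' g)) => [|s /H'G //].
  by rewrite sumr_const mulr_natl.
pose orb g h := [exists s in G, act s g == h].
have FG s g : s \in G -> F (act s g) = F g by move=> sG; rewrite /F HG ?KG.
have G0 : (#|G|%:R : C) != 0 by rewrite pnatr_eq0 -lt0n cardG_gt0.
have orbF i : i \in r -> (orbit_norm (e i) * gsum H (e i)) * (orbit_norm (e i) * gsum K (e i)) =
    \sum_(h <- level wt k | orb (e i) h) F h.
  move=> ir; have st0 : ((stab_card (e i))%:R : C) != 0 by rewrite pnatr_eq0 -lt0n stab_card_gt0.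
  rewrite mulrACA orbit_norm_sqr natrM !cst //.
  (* The orbit-stabilizer count: each point of the orbit is hit once for every element of the
     stabilizer. *)
  have E : #|G|%:R * F (e i) = (stab_card (e i))%:R * \sum_(h <- level wt k | orb (e i) h) F h.
    rewrite -(cst F) // /gsum.
    have D s : s \in G -> F (act s (e i)) =
        \sum_(h <- level wt k) if act s (e i) == h then F h else 0.
      move=> sG; rewrite -big_mkcond (big_rem (act s (e i))) /=; last first.
        by rewrite (mem_level fin) wt_act (rep_wt Hr).
      rewrite eqxx big_seq_cond big1 ?addr0 // => h /andP[].
      by rewrite mem_rem_uniq ?fset_uniq // !inE => /andP[/negbTE hn _]; rewrite eq_sym hn.
    rewrite (eq_bigr _ D) exchange_big /= mulr_sumr [RHS]big_mkcond /=.
    apply: eq_bigr => h _; rewrite -big_mkcondr /=.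
    rewrite {1}/orb; case: ifP => [/existsP[s /andP[sG /eqP Es]]|no].
      rewrite sumr_const -(card_transporter sG Es) mulr_natl; congr (_ *+ _).
      by apply: eq_card => t; rewrite !inE.
    rewrite big1 // => s /andP[sG Es]; exfalso; move/negbT/negP: no; apply.
    by apply/exists_inP; exists s.
  have -> : #|G|%:R * H (e i) * (#|G|%:R * K (e i)) = #|G|%:R * (#|G|%:R * F (e i)) by rewrite /F; ring.
  by rewrite E; field; rewrite G0 st0.
(* After exchanging the sums, each h of the level lies in the orbit of exactly one
   representative. *)
rewrite big_seq (eq_bigr _ orbF) -big_seq (exchange_big_dep xpredT) //=.
apply: eq_big_seq => h; rewrite (mem_level fin) => /eqP hk.
have [i ir [s sG si]] := rep_surj Hr hk.
rewrite (big_rem i) //= ifT; last by apply/exists_inP; exists s; rewrite ?si.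
rewrite big_seq_cond big1 ?addr0 // => j /andP[].
rewrite mem_rem_uniq ?(rep_uniq Hr) // !inE /orb => /andP[/eqP ji jr] /existsP[t /andP[tG /eqP tj]].
case: ji; apply: (rep_inj Hr (s := (t * s^-1)%g)) => //; first by rewrite groupM ?groupV.
by rewrite -actM tj -si actM mulgV act1.
Qed.

(** Only simultaneous invariance of f and g is assumed; averaging over the outer arguments makes
    both factors invariant in h, since a translation of h is absorbed by the averages. *)
Lemma contract_representatives (f g : J -> J -> J -> C) p q a l :
  (forall s p q h, s \in G -> f (act s p) (act s q) (act s h) = f p q h) ->
  (forall s h a l, s \in G -> g (act s h) (act s a) (act s l) = g h a l) ->
  \sum_(i <- r)
    (orbit_norm (e i) * gsum (fun p => gsum (fun q => gsum (f p q) (e i)) q) p) *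
    (orbit_norm (e i) * gsum (fun h => gsum (fun a => gsum (g h a) l) a) (e i)) =
  gsum (fun p => gsum (fun q => gsum (fun a => gsum (fun l =>
    \sum_(h <- level wt k) f p q h * g h a l) l) a) q) p.
Proof.
move=> f_act g_act.
have fE i : gsum (fun p => gsum (fun q => gsum (f p q) (e i)) q) p =
    gsum (fun h => gsum (fun p => gsum (fun q => f p q h) q) p) (e i).
  transitivity (gsum (fun p => gsum (fun h => gsum (fun q => f p q h) q) (e i)) p).
    by apply: eq_gsum => p'; exact: exchange_gsum.
  exact: exchange_gsum.
under eq_bigr do rewrite fE.
rewrite (sum_representatives (H := fun h => gsum (fun p => gsum (fun q => f p q h) q) p)
  (K := fun h => gsum (fun a => gsum (g h a) l) a)).
- rewrite /gsum; under eq_bigr => h _.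
    rewrite big_distrl /=; under eq_bigr => s _.
      rewrite big_distrl /=; under eq_bigr => t _.
        rewrite big_distrr /=; under eq_bigr => u _ do rewrite big_distrr /=.
      over.
    over.
  over.
  do 3![rewrite exchange_big; apply: eq_bigr => ? _].
  exact: exchange_big.
- move=> s h sG; rewrite -(gsum_act _ p sG); apply: eq_gsum => p' /=.
  by rewrite -(gsum_act _ q sG); apply: eq_gsum => q' /=; exact: f_act.
- move=> s h sG; rewrite -(gsum_act _ a sG); apply: eq_gsum => a' /=.
  by rewrite -(gsum_act _ l sG); apply: eq_gsum => l' /=; exact: g_act.
Qed.

End Representatives.

Lemma local_pair_gsum M D (A B : J -> int -> C) g :
  (forall s, s \in G -> local_pair M D (A (act s g)) (B (act s g))) ->
  local_pair M D (fun k => gsum (A^~ k) g) (fun k => gsum (B^~ k) g).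
Proof.
move=> loc k; rewrite !iter_deltaE /gsum.
under eq_bigr do rewrite mulr_sumr.
under [in RHS]eq_bigr do rewrite mulr_sumr.
rewrite exchange_big [RHS]exchange_big; apply: eq_bigr => s sG.
by have := loc s sG k; rewrite !iter_deltaE.
Qed.

Context (mu : nat -> nat -> nat) (vac : J) (c : J -> J -> J -> C).
Hypothesis Hc : vertex_constants wt (fun q r => mu (wt q) (wt r)) vac c.
Hypothesis c_act : forall s p q r, c (act s p) (act s q) (act s r) = c p q r.
Hypothesis act_vac : forall s, act s vac = vac.

Definition orbit_const p q r : C :=
  orbit_norm p * orbit_norm q * orbit_norm r *
  gsum (fun p => gsum (fun q => gsum (c p q) r) q) p.

(** The inner product of two normalized orbit vectors; on representatives it becomes the Kronecker
    symbol. *)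
Definition orbit_pairing p r : C :=
  orbit_norm p * orbit_norm r * gsum (fun p => gsum (fun r => (p == r)%:R) r) p.

Lemma orbit_pairing_id p : orbit_pairing p p = 1.
Proof.
have E : gsum (fun q => gsum (fun r => (q == r)%:R) p) p = (#|G| * stab_card p)%:R :> C.
  rewrite /gsum natrM mulr_natl -sumr_const; apply: eq_bigr => s sG.
  rewrite -(card_transporter sG erefl) -sum1_card natr_sum big_mkcond [RHS]big_mkcond /=.
  apply: eq_bigr => t _; rewrite !inE; case: (t \in G) => //=.
  by rewrite eq_sym; case: (_ == _).
rewrite /orbit_pairing E orbit_norm_sqr mulVf // pnatr_eq0 -lt0n.
by rewrite muln_gt0 cardG_gt0 stab_card_gt0.
Qed.

Lemma orbit_pairing_neq p r :
  (forall s, s \in G -> act s p <> r) -> orbit_pairing p r = 0.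
Proof.
move=> pr; rewrite /orbit_pairing /gsum big1 ?mulr0 // => s sG.
rewrite big1 // => t tG; case: eqP => // E; exfalso.
by apply: (pr (s * t^-1)%g); rewrite ?groupM ?groupV // -actM E actM mulgV act1.
Qed.

Lemma gsum_vac (F : J -> C) : gsum F vac = #|G|%:R * F vac.
Proof.
rewrite /gsum (eq_bigr (fun=> F vac)) => [|s _]; last by rewrite act_vac.
by rewrite sumr_const mulr_natl.
Qed.

Lemma orbit_norm_vac : orbit_norm vac * #|G|%:R = 1.
Proof.
rewrite /orbit_norm /stab_card (_ : [set s in G | _]%SET = G); last first.
  by apply/setP => s; rewrite inE act_vac eqxx andbT.
by rewrite natrM -expr2 sqrCK ?ler0n // mulVf // pnatr_eq0 -lt0n cardG_gt0.
Qed.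

Lemma orbit_norm_gsum_vac (F : J -> C) : orbit_norm vac * gsum F vac = F vac.
Proof. by rewrite gsum_vac mulrA orbit_norm_vac mul1r. Qed.

Lemma orbit_const_vacuum p r : orbit_const p vac r = orbit_pairing p r.
Proof.
have E : gsum (fun p => gsum (fun r => (p == r)%:R) r) p =
    orbit_norm vac * gsum (fun p => gsum (fun q => gsum (c p q) r) vac) p.
  rewrite gsumZ; apply: eq_gsum => p'; rewrite orbit_norm_gsum_vac.
  by apply: eq_gsum => r'; rewrite (vc_vacuum Hc).
by rewrite /orbit_const /orbit_pairing E; ring.
Qed.

Lemma orbit_const_creation p q : (wt p <= wt q)%N ->
  orbit_const p q vac = orbit_pairing p q.
Proof.
move=> pq; rewrite /orbit_const /orbit_pairing -mulrA; congr (_ * _).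
rewrite gsumZ; apply: eq_bigr => s _; rewrite gsumZ; apply: eq_bigr => t _.
by rewrite orbit_norm_gsum_vac (vc_creation Hc) // !wt_act.
Qed.

Section Identities.
Context (T : choiceType) (e : T -> J).

Lemma orbit_four_point (t : seq T) k p q a l : representatives t e k ->
  \sum_(i <- t) orbit_const p q (e i) * orbit_const (e i) a l =
  orbit_norm p * orbit_norm q * orbit_norm a * orbit_norm l *
  gsum (fun p => gsum (fun q => gsum (fun a => gsum (fun l =>
    four_point wt c p q a l k) l) a) q) p.
Proof.
move=> ht; rewrite -(contract_representatives ht) // mulr_sumr.
apply: eq_bigr => i _; rewrite /orbit_const; ring.
Qed.

Lemma orbit_const_translation (t t' : seq T) p q r :
  representatives t e ((wt p)%:Z - 1) -> representatives t' e ((wt r)%:Z + 1) ->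
  \sum_(i <- t) orbit_const p (e i) vac * orbit_const (e i) q r -
  \sum_(i <- t') orbit_const p q (e i) * orbit_const (e i) r vac =
  ((wt p)%:Z - (wt q)%:Z - (wt r)%:Z)%:~R * orbit_const p q r.
Proof.
move=> ht h'; rewrite (orbit_four_point _ _ _ _ h').
(* Here the contracted index is in the middle slot, so the averages over it and over the vacuum are
   exchanged before contracting. *)
have -> : \sum_(i <- t) orbit_const p (e i) vac * orbit_const (e i) q r =
    orbit_norm p * orbit_norm vac * orbit_norm q * orbit_norm r *
    gsum (fun p => gsum (fun v => gsum (fun q => gsum (fun r =>
      \sum_(h <- level wt ((wt p)%:Z - 1)) c p h v * c h q r) r) q) vac) p.
  transitivity (orbit_norm p * orbit_norm vac * orbit_norm q * orbit_norm r *
    gsum (fun p' => gsum (fun v => gsum (fun q => gsum (fun r =>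
      \sum_(h <- level wt ((wt p)%:Z - 1)) c p' h v * c h q r) r) q) vac) p); last first.
    by congr (_ * _); apply: eq_bigr => s _; rewrite wt_act.
  rewrite -(contract_representatives ht (f := fun p v h => c p h v)) // mulr_sumr.
  apply: eq_bigr => i _; rewrite /orbit_const.
  have -> : gsum (fun p => gsum (fun q => gsum (c p q) vac) (e i)) p =
      gsum (fun p => gsum (fun v => gsum (c p ^~ v) (e i)) vac) p.
    by apply: eq_gsum => p'; rewrite exchange_gsum.
  ring.
have scaleE (F F' : J -> J -> J -> C) K :
  (forall s s' s'', F (act s p) (act s' q) (act s'' r) - F' (act s p) (act s' q) (act s'' r) =
     K * c (act s p) (act s' q) (act s'' r)) ->
  gsum (fun p => gsum (fun q => gsum (F p q) r) q) p -
  gsum (fun p => gsum (fun q => gsum (F' p q) r) q) p =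
  K * gsum (fun p => gsum (fun q => gsum (c p q) r) q) p.
  move=> FE; rewrite /gsum -sumrB mulr_sumr; apply: eq_bigr => s _.
  rewrite -sumrB mulr_sumr; apply: eq_bigr => s' _.
  by rewrite -sumrB mulr_sumr; apply: eq_bigr => s'' _.
rewrite /orbit_const [RHS]mulrCA.
rewrite -(scaleE (fun p q r => \sum_(h <- level wt ((wt p)%:Z - 1)) c p h vac * c h q r)
  (fun p q r => \sum_(h <- level wt ((wt r)%:Z + 1)) c p q h * c h r vac)); last first.
  by move=> s s' s''; rewrite (vc_translation Hc) !wt_act.
rewrite mulrBr; congr (_ - _).
  rewrite [orbit_norm p * orbit_norm vac]mulrC -!mulrA.
  rewrite mulrCA; congr (_ * _); rewrite mulrCA; congr (_ * _).
  rewrite mulrCA; congr (_ * _).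
  by rewrite gsumZ; apply: eq_gsum => p'; rewrite orbit_norm_gsum_vac.
rewrite -!mulrA; congr (_ * (_ * (_ * _))).
rewrite !gsumZ; apply: eq_gsum => p'; rewrite !gsumZ; apply: eq_gsum => q'.
rewrite gsumZ; apply: eq_bigr => s _.
by rewrite orbit_norm_gsum_vac /four_point wt_act.
Qed.

(** Representatives are required only at the levels entering the difference at [k0]; these are
    finitely many, so one N can serve them all. *)
Lemma orbit_const_local (t : int -> seq T) p q r l (k0 : int) :
  let M := mu (wt q) (wt r) in
  let D := (wt p + wt l)%N%:Z in
  (forall j : 'I_M.+1, representatives (t (k0 - j%:Z)) e (k0 - j%:Z)) ->
  (forall j : 'I_M.+1, representatives (t (D - (k0 - j%:Z))) e (D - (k0 - j%:Z))) ->
  iter M (@delta C) (fun k => \sum_(i <- t k) orbit_const p q (e i) * orbit_const (e i) r l) k0 =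
  iter M (@delta C) (fun k => \sum_(i <- t (D - k)) orbit_const p r (e i) * orbit_const (e i) q l) k0.
Proof.
move=> M D ht ht'; rewrite !iter_deltaE.
under eq_bigr => j _ do rewrite (orbit_four_point _ _ _ _ (ht j)).
under [in RHS]eq_bigr => j _ do rewrite (orbit_four_point _ _ _ _ (ht' j)).
have loc : local_pair M D
    (fun k => gsum (fun p => gsum (fun q => gsum (fun r => gsum (fun l =>
      four_point wt c p q r l k) l) r) q) p)
    (fun k => gsum (fun p => gsum (fun q => gsum (fun r => gsum (fun l =>
      four_point wt c p r q l k) l) r) q) p).
  apply: (@local_pair_gsum _ _ (fun p k => gsum (fun q => gsum (fun r => gsum (fun l =>
      four_point wt c p q r l k) l) r) q) (fun p k => gsum (fun q => gsum (fun r => gsum (fun l =>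
      four_point wt c p r q l k) l) r) q)) => s1 _.
  apply: (@local_pair_gsum _ _ (fun q k => gsum (fun r => gsum (fun l =>
      four_point wt c (act s1 p) q r l k) l) r) (fun q k => gsum (fun r => gsum (fun l =>
      four_point wt c (act s1 p) r q l k) l) r)) => s2 _.
  apply: (@local_pair_gsum _ _ (fun r k => gsum (fun l =>
      four_point wt c (act s1 p) (act s2 q) r l k) l) (fun r k => gsum (fun l =>
      four_point wt c (act s1 p) r (act s2 q) l k) l)) => s3 _.
  apply: (@local_pair_gsum _ _ (fun l k =>
      four_point wt c (act s1 p) (act s2 q) (act s3 r) l k) (fun l k =>
      four_point wt c (act s1 p) (act s3 r) (act s2 q) l k)) => s4 _.
  have := vc_local Hc (act s1 p) (act s2 q) (act s3 r) (act s4 l).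
  by rewrite !wt_act.
have {loc} := loc k0; rewrite !iter_deltaE.
move=> /(congr1 ( *%R (orbit_norm p * orbit_norm q * orbit_norm r * orbit_norm l))).
rewrite !mulr_sumr => E.
transitivity (\sum_(i < M.+1) orbit_norm p * orbit_norm q * orbit_norm r * orbit_norm l *
  ((-1) ^+ i * 'C(M, i)%:R * gsum (fun p => gsum (fun q => gsum (fun r => gsum (fun l =>
      four_point wt c p q r l (k0 - i%:Z)) l) r) q) p)).
  by apply: eq_bigr => i _; ring.
rewrite E; apply: eq_bigr => i _.
(* The second ordering averages over r before q. *)
have -> : forall F : J -> J -> J -> J -> C,
   gsum (fun p => gsum (fun q => gsum (fun r => gsum (fun l => F p q r l) l) r) q) p =
   gsum (fun p => gsum (fun r => gsum (fun q => gsum (fun l => F p q r l) l) q) r) p.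
  by move=> F; apply: eq_gsum => p'; rewrite exchange_gsum.
ring.
Qed.

End Identities.
End Orbits.

(** * The structure constants of the fixed points *)

Section TensorModes.
Context (C : numClosedFieldType) (V : unitary_voa C) (Phi : homogeneous_onb V).
Context (X : finType).
Local Notation wt := (@elt_wt C V Phi).
Local Notation J := {ffun X -> elt Phi}.
Local Notation T := (tpow Phi X).
Local Notation tc := (@tconst C (elt Phi) (@basis_const C V Phi) X).
Local Notation form := (@Defs.form C V).
Implicit Types (g h l : J) (u v : T).

(** Each a(x) has finitely many coordinates; a function taking a value outside their union [E] has a
    zero factor, so the sum over all functions is finite. *)
Lemma mcoeff_tens (a : X -> V) g :
  mcoeff g (tens Phi a) = \prod_x form (elt_val (g x)) (a x).
Proof.
have [D DE] : {D : X -> {fset elt Phi} & forall x p, p \notin D x -> form (elt_val p) (a x) = 0}.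
  apply: (@choice _ _ (fun x (D : {fset elt Phi}) => forall p, p \notin D -> form (elt_val p) (a x) = 0)) => x.
  have [D aD] := elt_expansion Phi (a x); exists D => p pD.
  rewrite (aD D) // form_sumZ big_seq big1 // => q qD; rewrite form_elt.
  by case: eqVneq => [pq|]; rewrite ?mulr0 //; rewrite pq qD in pD.
pose E := (\bigcup_(x <- enum X) D x)%fset.
pose A := fset_set [set h : J | forall x, h x \in E].
have AP h : (h \in A) = [forall x, h x \in E].
  rewrite in_fset_set; last exact: finite_set_ffun_in.
  by apply/idP/forallP; rewrite inE.
have nA h : h \notin A -> \prod_x form (elt_val (h x)) (a x) = 0.
  rewrite AP negb_forall => /existsP[x hx].
  rewrite (bigD1 x) //= DE ?mul0r //; apply: contra hx => hx.
  by apply/bigfcupP; exists x; rewrite ?mem_enum.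
rewrite /tens (fsbigTE A) => [|h /nA ->]; last by rewrite scale0r.
rewrite raddf_sum /=; under eq_bigr do rewrite mcoeffZ mcoeff_basis mulr_natr mulrb.
rewrite -big_mkcond /=; have [gA|gA] := boolP (g \in A).
  by rewrite -big_filter filter_pred1_uniq ?fset_uniq // big_seq1.
rewrite nA // big_seq_cond big1 // => h /andP[hA /eqP E'].
by rewrite -E' hA in gA.
Qed.

(** At each site the weights determine the mode, so [K g] is the only family of modes that can
    produce g, and its total index encodes the weight of g. *)
Lemma mcoeff_tens_mode h m l g :
  mcoeff g (tens_mode Phi (fun x => elt_val (h x)) m (fun x => elt_val (l x))) =
  if (twt wt g)%:Z == (twt wt h)%:Z + (twt wt l)%:Z - m - 1 then tc g h l else 0.
Proof.
pose K g := [ffun x => (wt (h x))%:Z + (wt (l x))%:Z - (wt (g x))%:Z - 1].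
pose F (k : {ffun X -> int}) := tens Phi (fun x => mode (elt_val (h x)) (k x) (elt_val (l x))).
have FE g' k : mcoeff g' (F k) = if k == K g' then tc g' h l else 0.
  rewrite mcoeff_tens; case: eqP => [->|nk].
    by apply: eq_bigr => x _; rewrite ffunE form_modeE ifT //; lia.
  have /existsP[x kx] : [exists x, k x != K g' x].
    rewrite -negb_forall; apply/negP => /forallP e; apply: nk.
    by apply/ffunP => x; apply/eqP.
  rewrite (bigD1 x) //= form_modeE ifF ?mul0r //.
  apply/negP => /eqP e; move/negP: kx; apply; apply/eqP; rewrite ffunE; lia.
have sumK g' : \sum_x (K g' x + 1) = (twt wt h)%:Z + (twt wt l)%:Z - (twt wt g')%:Z.
  rewrite /twt !(big_morph Posz PoszD (erefl 0)) -big_split -sumrB /=.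
  by apply: eq_bigr => x _; rewrite ffunE subrK.
pose lev := level (@twt _ wt X) ((twt wt h)%:Z + (twt wt l)%:Z - m - 1).
have finT := finite_levels_twt (@finite_levels_elt C V Phi) X.
have levP g' : (g' \in lev) = ((twt wt g')%:Z == (twt wt h)%:Z + (twt wt l)%:Z - m - 1).
  exact: (mem_level finT).
(* The families that contribute come from the finite level [lev]; this makes the sum over all
   families finite. *)
pose A := [fset K g' | g' in lev]%fset.
have AP k : k \in A -> \sum_x (k x + 1) = m + 1.
  by move=> /imfsetP[g' /= + ->]; rewrite levP sumK => /eqP; lia.
have PA k g' : k = K g' -> \sum_x (k x + 1) = m + 1 -> k \in A.
  move=> -> E; apply/imfsetP; exists g' => //=; rewrite levP; apply/eqP.
  by rewrite sumK in E; lia.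
rewrite /tens_mode (fsbigE A) ?fset_uniq //.
- rewrite raddf_sum /=; under eq_bigr do rewrite -/(F _) FE.
  rewrite -big_mkcondr /= -[LHS]big_filter.
  have -> : [seq k <- A | (k \in [set k : {ffun X -> int} | \sum_x (k x + 1) = m + 1]) & k == K g] =
      [seq k <- A | k == K g].
    by apply: eq_in_filter => k kA; rewrite mem_set //; exact: AP.
  case: ifPn => hg.
    rewrite filter_pred1_uniq ?fset_uniq ?big_seq1 //.
    by apply: (PA _ g) => //; rewrite sumK; move/eqP: hg; lia.
  rewrite big_filter big_seq_cond big1 // => k /andP[kA /eqP kE]; exfalso.
  by move/eqP: hg; apply; have := AP _ kA; rewrite kE sumK; lia.
- move=> k /= kE kA; apply/malgP => g'; rewrite -/(F _) FE mcoeff0.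
  by case: eqP => // kg; rewrite (PA _ _ kg kE) in kA.
Qed.

Lemma tmodeE u m v : tmode u m v = mlift (fun h => mlift (fun l =>
  tens_mode Phi (fun x => elt_val (h x)) m (fun x => elt_val (l x))) v) u.
Proof.
by apply: eq_bigr => h _; rewrite scaler_sumr; apply: eq_bigr => l _; rewrite scalerA.
Qed.

Lemma tformE u v : tform u v = \sum_(g <- msupp u) (mcoeff g u)^* * mcoeff g v.
Proof.
apply: eq_bigr => g _.
have E h : h \in msupp v -> (mcoeff g u)^* * mcoeff h v *
      \prod_x form (elt_val (g x)) (elt_val (h x)) =
    if h == g then (mcoeff g u)^* * mcoeff g v else 0.
  move=> _; case: eqVneq => [->|hg].
    by rewrite big1 ?mulr1 // => x _; rewrite form_elt eqxx.
  have /existsP[x gx] : [exists x, g x != h x].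
    rewrite -negb_forall; apply: contra hg => /forallP e.
    by rewrite eq_sym; apply/eqP/ffunP => x; apply/eqP.
  by rewrite (bigD1 x) //= form_elt (negbTE gx) mul0r mulr0.
rewrite (eq_big_seq _ E) -big_mkcond /=.
have [gv|gv] := boolP (g \in msupp v).
  by rewrite -big_filter filter_pred1_uniq ?fset_uniq // big_seq1.
by rewrite (mcoeff_outdom gv) mulr0 big1.
Qed.

Section Orbits.
Context (G : {group {perm X}}).

Lemma mlift_orbit_sum (W : lmodType C) (F : J -> W) g :
  mlift F (orbit_sum G g) = \sum_(s in G) F (fact s g).
Proof.
by rewrite /orbit_sum linear_sum; apply: eq_bigr => s _; exact: mliftU.
Qed.

(** The form is antilinear on the left, so its conjugate is a linear extension from the basis, and
    [mlift_orbit_sum] applies. *)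
Lemma tform_orbit_sum g v : tform (orbit_sum G g) v = \sum_(s in G) mcoeff (fact s g) v.
Proof.
rewrite tformE; apply: (can_inj (@conjCK C)).
rewrite !rmorph_sum /=.
transitivity (mlift (fun h => (mcoeff h v)^* : C^o) (orbit_sum G g)).
  by apply: eq_bigr => h _; rewrite rmorphM /= conjCK.
exact: mlift_orbit_sum.
Qed.

Lemma orbit_vecE g : orbit_vec G g =
  orbit_norm C G (@fact C V Phi X) g *: orbit_sum G g.
Proof.
rewrite /orbit_vec /orbit_norm tform_orbit_sum; congr ((sqrtC _)^-1 *: _).
rewrite natrM mulr_natl -sumr_const; apply: eq_bigr => s sG.
rewrite -(card_transporter (@factM _ _ _ X) (@fact1 _ _ _ X) sG erefl) /orbit_sum raddf_sum /=.
rewrite -sum1_card natr_sum big_mkcond [RHS]big_mkcond /=.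
apply: eq_bigr => t _; rewrite !inE; case: (t \in G) => //=.
by rewrite mcoeff_basis; case: (_ == _).
Qed.

Lemma twt_fact s g : twt wt (fact s g) = twt wt g.
Proof.
rewrite /twt [RHS](reindex_inj (@perm_inj _ s^-1%g)) /=.
by apply: eq_bigr => x _; rewrite ffunE.
Qed.

Lemma tconst_fact s g h l : tc (fact s g) (fact s h) (fact s l) = tc g h l.
Proof.
rewrite /tconst [RHS](reindex_inj (@perm_inj _ s^-1%g)) /=.
by apply: eq_bigr => x _; rewrite !ffunE.
Qed.

Lemma orbit_norm_conj g : (orbit_norm C G (@fact C V Phi X) g)^* =
  orbit_norm C G (@fact C V Phi X) g.
Proof.
by apply: conj_Creal; rewrite ger0_real // invr_ge0 sqrtC_ge0 ler0n.
Qed.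

Lemma orbit_structure_constE g h l : orbit_structure_const G g h l =
  orbit_const G (@fact C V Phi X) tc g h l.
Proof.
rewrite /orbit_structure_const !orbit_vecE.
have tformZ a u v : tform (a *: u) v = a^* * tform u v.
  have lE (w : T) : tform w v = (mlift (fun h => (mcoeff h v)^* : C^o) w)^*.
    rewrite tformE /mlift rmorph_sum /=; apply: eq_bigr => h' _.
    by rewrite rmorphM /= conjCK.
  by rewrite !lE linearZ /= rmorphM.
rewrite tformZ tform_orbit_sum orbit_norm_conj /orbit_const.
rewrite -!mulrA; congr (_ * _).
have E s : mcoeff (fact s g) (tmode (orbit_norm C G (@fact C V Phi X) h *: orbit_sum G h)
    ((fwt l)%:Z + (fwt h)%:Z - (fwt g)%:Z - 1)
    (orbit_norm C G (@fact C V Phi X) l *: orbit_sum G l)) =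
   orbit_norm C G (@fact C V Phi X) h * (orbit_norm C G (@fact C V Phi X) l *
   \sum_(t in G) \sum_(u in G) tc (fact s g) (fact t h) (fact u l)).
  rewrite tmodeE linearZ /= mlift_orbit_sum mcoeffZ raddf_sum /=; congr (_ * _).
  rewrite mulr_sumr; apply: eq_bigr => t _.
  rewrite linearZ /= mlift_orbit_sum mcoeffZ raddf_sum /=; congr (_ * _).
  apply: eq_bigr => u _; rewrite mcoeff_tens_mode ifT // !twt_fact.
  have fwtE g' : fwt g' = twt wt g' by [].
  by apply/eqP; rewrite !fwtE; lia.
by rewrite (eq_bigr _ (fun s _ => E s)) -!mulr_sumr.
Qed.

End Orbits.
End TensorModes.

(** * The limit *)

Section Limits.
Context (R : realType).
Implicit Types (u v : nat -> R[i]^o) (a b : R[i]^o).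

Lemma cvgn_sum (T : Type) (r : seq T) (u : T -> nat -> R[i]^o) (a : T -> R[i]^o) :
  (forall t, u t N @[N --> \oo] --> a t) ->
  \sum_(t <- r) u t N @[N --> \oo] --> \sum_(t <- r) a t.
Proof.
move=> ua; elim: r => [|t r IH].
  rewrite big_nil; under eq_fun do rewrite big_nil; exact: cvg_cst.
rewrite big_cons; under eq_fun do rewrite big_cons; exact: (cvgD (ua t) IH).
Qed.

Lemma cvgn_eq u a b N0 : u N @[N --> \oo] --> a ->
  (forall N, (N0 <= N)%N -> u N = b) -> a = b.
Proof.
move=> ua ub; apply: (cvg_unique _ ua); first exact: norm_hausdorff.
by apply: cvg_near_cst; exists N0.
Qed.

End Limits.

Section Limit.
Context (R : realType) (V : unitary_voa R[i]) (Phi : homogeneous_onb V).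
Context (x : nat -> nat) (x_incr : {homo x : M N / (M < N)%N >-> (M < N)%N}).
Context (G : forall N, {group 'S_(x N)}) (Nn : nat -> nat).
Context (B : forall n, {pred {ffun 'I_(x (Nn n)) -> elt Phi}}).
Hypothesis hB : orbit_representatives G B.
Local Notation wt := (@elt_wt R[i] V Phi).
Local Notation c := (@basis_const R[i] V Phi).

Definition rwt (g : reps B) : nat := fwt (rep_fun g).

Definition rep_ext N (g : reps B) : {ffun 'I_(x N) -> elt Phi} := vac_ext x (rep_fun g) N.

Lemma rwtE g : rwt g = tag g.
Proof. by case: (hB (leqnn (Nn (tag g)))) => h _ _; apply: h; exact: (valP (tagged g)). Qed.

Lemma fwt_vac_ext n (g : {ffun 'I_n -> elt Phi}) N :
  (n <= x N)%N -> fwt (vac_ext x g N) = fwt g.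
Proof.
(* Site weights extended by 0 to all naturals, matching the weight of the vacuum used for
   padding. *)
move=> nN; pose F k := if insub k is Some j then wt (g j) else 0%N.
have -> : fwt g = (\sum_(i < n) F i)%N.
  by apply: eq_bigr => i _; rewrite /F valK.
rewrite (big_ord_widen _ F nN) big_mkcond /=; apply: eq_bigr => i _.
by rewrite ffunE /F; case: insubP => [j -> _|/negbTE ->].
Qed.

Lemma x_homo M N : (M <= N)%N -> (x M <= x N)%N.
Proof. by rewrite leq_eqVlt => /orP[/eqP -> //|/x_incr /ltnW]. Qed.

Lemma twt_rep_ext N g : (Nn (rwt g) <= N)%N -> twt wt (rep_ext N g) = rwt g.
Proof. by move=> gN; apply: fwt_vac_ext; apply: x_homo; rewrite -rwtE. Qed.

Lemma rep_ext_inj N g h s : (Nn (rwt g) <= N)%N -> rwt g = rwt h -> s \in G N ->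
  fact s (rep_ext N g) = rep_ext N h -> g = h.
Proof.
rewrite !rwtE; case: g h => [n [g gB]] [m [h hB']] /= + nm.
case: _ / nm in h hB' * => nN sG E.
congr (Tagged _ _); apply: val_inj => /=.
case: (hB nN) => _ _; apply=> //.
by exists s.
Qed.

(** [B n] is only a predicate; it is finite because its members are distinct functions in a finite
    level of one tensor power. *)
Lemma finite_levels_rwt : finite_levels rwt.
Proof.
move=> n; apply: (@sub_finite_set _ _ ([set g | rwt g = n] `&`
    rep_ext (Nn n) @^-1` [set h | twt wt h = n])).
  by move=> g /= gn; split=> //=; rewrite twt_rep_ext ?gn.
(* The weight is recorded next to the function because [rep_ext_inj] compares representatives of
   equal weight. *)
rewrite (_ : _ `&` _ = (fun g => (rwt g, rep_ext (Nn n) g)) @^-1`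
    ([set n] `*` [set h | twt wt h = n])); last by apply/seteqP; split.
apply: finite_preimage; last first.
  by apply: finite_setX => //; exact: (finite_levels_twt (@finite_levels_elt _ V Phi)).
move=> g h; rewrite !inE /= => -[gn _] [hn _] [_ E].
by apply: (@rep_ext_inj (Nn n) g h 1%g); rewrite ?group1 ?gn ?hn // fact1.
Qed.

(** For negative k the condition on N is vacuous and the level is empty, so the differences of
    locality may run below weight 0. *)
Lemma rep_representatives N (k : int) : (forall n, n%:Z = k -> (Nn n <= N)%N) ->
  representatives (twt wt (X := _)) (G N) (@fact _ V Phi _) (level rwt k) (rep_ext N) k.
Proof.
move=> kN; split.
- exact: fset_uniq.
- move=> g; rewrite (mem_level finite_levels_rwt) => /eqP gk.
  by rewrite twt_rep_ext // kN.
- move=> h hk; have [_ /(_ h erefl) [g gB [s sG sh]] _] := hB (kN _ hk).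
  pose g' : reps B := Tagged (fun n => {g | g \in @B n}) (exist _ g gB).
  exists g'; last by exists s.
  by rewrite (mem_level finite_levels_rwt) rwtE; apply/eqP.
- move=> g h s; rewrite !(mem_level finite_levels_rwt) => /eqP gk /eqP hk sG E.
  apply: (rep_ext_inj _ _ sG E); first exact: kN.
  by apply/eqP; rewrite -eqz_nat gk hk.
Qed.

Lemma vacuum_rep : exists g0 : reps B, forall i, rep_fun g0 i = elt_vac Phi.
Proof.
have [h0 /(_ [ffun=> elt_vac Phi]) surj _] := hB (leqnn (Nn 0)).
have [|g gB _] := surj; first by rewrite /fwt big1 // => i _; rewrite ffunE.
exists (Tagged (fun n => {g | g \in @B n}) (exist _ g gB)) => i.
have gi : (wt (g i) <= fwt g)%N by rewrite /fwt (bigD1 i) //= leq_addr.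
by apply: elt_wt_eq0; apply/eqP; rewrite (h0 g gB) leqn0 in gi.
Qed.

Context (f : reps B -> reps B -> reps B -> R[i]^o).
Hypothesis hf : forall g1 g2 g3 : reps B,
  structure_const G g1 g2 g3 N @[N --> \oo] --> f g1 g2 g3.
Context (g0 : reps B) (g0_vac : forall i, rep_fun g0 i = elt_vac Phi).

Local Notation oc N := (orbit_const (G N) (@fact _ V Phi _) (@tconst _ _ c _)).

Lemma rep_ext_vac N : rep_ext N g0 = tvac (elt_vac Phi) _.
Proof. by apply/ffunP => i; rewrite !ffunE; case: insub. Qed.

Lemma structure_constE p q r N :
  structure_const G p q r N = oc N (rep_ext N p) (rep_ext N q) (rep_ext N r).
Proof. exact: orbit_structure_constE. Qed.

Lemma rep_pairing N p r : (Nn (rwt p) <= N)%N -> (Nn (rwt r) <= N)%N ->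
  orbit_pairing R[i] (G N) (@fact _ V Phi _) (rep_ext N p) (rep_ext N r) = (p == r)%:R.
Proof.
move=> pN rN; case: eqVneq => [->|pr].
  by apply: orbit_pairing_id; [exact: factM | exact: fact1].
apply: orbit_pairing_neq; [exact: factM|exact: fact1|] => s sG E.
case/eqP: pr; apply: (rep_ext_inj pN _ sG E).
by rewrite -(twt_rep_ext pN) -(twt_rep_ext rN) -E twt_fact.
Qed.

Definition limit_local_order (q r : reps B) : nat :=
  tlocal_order wt (@basis_local_order _ V Phi) (rwt q) (rwt r).

Let tfin N := finite_levels_twt (@finite_levels_elt _ V Phi) 'I_(x N).
Let tcP N := tensor_constants (@finite_levels_elt _ V Phi) (basis_constants Phi)
  (@elt_wt_eq0 _ V Phi) 'I_(x N).
Let factvac N (s : 'S_(x N)) : fact s (tvac (elt_vac Phi) _) = tvac (elt_vac Phi) _.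
Proof. by apply/ffunP => i; rewrite !ffunE. Qed.

(** Levels of [rwt] are finite and do not depend on N. Each identity therefore involves a fixed
    finite set of representatives and holds exactly for [oc N] once N is large; continuity of sums
    and products does the rest. *)
Theorem limit_constants : vertex_constants rwt limit_local_order g0 f.
Proof.
pose sc (N : nat) (p q r : reps B) : R[i] := structure_const G p q r N.
have cvg_pair p q s1 s2 r l : sc N p q s1 * sc N s2 r l @[N --> \oo] -->
    (f p q s1 * f s2 r l : R[i]^o) by exact: (cvgM (@hf _ _ _) (@hf _ _ _)).
have cvg_four p q r l k : four_point rwt (sc N) p q r l k @[N --> \oo] -->
    (four_point rwt f p q r l k : R[i]^o) by apply: cvgn_sum => s; exact: cvg_pair.
(* One threshold beyond [Nn n] for all n <= K; a sum serves as a bound for the maximum. *)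
have large K : exists N0, forall n N, (N0 <= N)%N -> (n <= K)%N -> (Nn n <= N)%N.
  exists (\sum_(n < K.+1) Nn n)%N => n N NN nK; apply: leq_trans NN.
  rewrite -ltnS in nK.
  by rewrite (bigD1 (Ordinal nK)) //= leq_addr.
have w0 : rwt g0 = 0%N by rewrite /rwt /fwt big1 // => i _; rewrite g0_vac.
split=> //.
- move=> p r; apply: (@cvgn_eq _ _ _ _ (maxn (Nn (rwt p)) (Nn (rwt r))) (@hf p g0 r)) => N.
  rewrite geq_max => /andP[pN rN]; rewrite structure_constE rep_ext_vac.
  by rewrite (orbit_const_vacuum _ (tcP N) (@factvac N)) rep_pairing.
- move=> p q pq.
  apply: (@cvgn_eq _ _ _ _ (maxn (Nn (rwt p)) (Nn (rwt q))) (@hf p q g0)) => N.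
  rewrite geq_max => /andP[pN qN]; rewrite structure_constE rep_ext_vac.
  by rewrite (orbit_const_creation _ (@twt_fact _ V Phi _) (tcP N) (@factvac N)) ?rep_pairing ?twt_rep_ext.
- move=> p q r.
  (* The successor accounts for the intermediate level [rwt r + 1]. *)
  have [N0 N0P] := large (rwt p + rwt r + rwt q).+1.
  have lim1 := cvgB (@cvgn_sum _ _ (level rwt ((rwt p)%:Z - 1)) _ _ (fun s => cvg_pair p s g0 s q r))
    (@cvgn_sum _ _ (level rwt ((rwt r)%:Z + 1)) _ _ (fun s => cvg_pair p q s s r g0)).
  have lim2 := cvgM (cvg_cst (((rwt p)%:Z - (rwt q)%:Z - (rwt r)%:Z)%:~R : R[i]^o)) (@hf p q r).
  apply/eqP; rewrite -subr_eq0; apply/eqP.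
  have FF : Filter (\oo : set_system nat) by exact: _.
  have E := @cvgn_eq _ _ _ 0 N0 (cvgB (lim1 FF) (lim2 FF FF)).
  apply: (E FF) => N NN.
  have [pN qN rN] : [/\ twt wt (rep_ext N p) = rwt p, twt wt (rep_ext N q) = rwt q &
      twt wt (rep_ext N r) = rwt r].
    by split; apply: twt_rep_ext; apply: (N0P _ _ NN); lia.
  have T : \sum_(s <- level rwt ((rwt p)%:Z - 1)) sc N p s g0 * sc N s q r -
      \sum_(s <- level rwt ((rwt r)%:Z + 1)) sc N p q s * sc N s r g0 =
      ((rwt p)%:Z - (rwt q)%:Z - (rwt r)%:Z)%:~R * sc N p q r.
    rewrite /sc; under eq_bigr do rewrite !structure_constE rep_ext_vac.
    under [X in _ - X]eq_bigr do rewrite !structure_constE rep_ext_vac.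
    rewrite structure_constE -pN -qN -rN.
    apply: (orbit_const_translation (tfin N) (@factM _ _ _ _) (@fact1 _ _ _ _) (@twt_fact _ _ _ _)
      (tcP N) (@tconst_fact _ _ _ _) (@factvac N)).
      by rewrite pN; apply: rep_representatives => n nk; apply: (N0P _ _ NN); lia.
    by rewrite rN; apply: rep_representatives => n nk; apply: (N0P _ _ NN); lia.
  by apply/eqP; rewrite subr_eq0; apply/eqP; exact: T.
- move=> p q r l k0.
  pose M := limit_local_order q r.
  (* This bounds all levels k0 - j and D - (k0 - j) for j <= M, where D = rwt p + rwt l. *)
  have [N0 N0P] := large (rwt p + rwt q + rwt r + rwt l + M + `|k0|)%N.
  pose diff (c' : reps B -> reps B -> reps B -> R[i]) p' q' r' l' (D : int -> int) : R[i]^o :=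
    iter M (@delta R[i]) (fun k => four_point rwt c' p' q' r' l' (D k)) k0.
  have lim p' q' r' l' (D : int -> int) :
      diff (sc N) p' q' r' l' D @[N --> \oo] --> diff f p' q' r' l' D.
    rewrite /diff iter_deltaE; under eq_fun do rewrite iter_deltaE.
    apply: cvgn_sum => j; exact: (cvgM (cvg_cst _) (cvg_four p' q' r' l' (D (k0 - j%:Z)))).
  apply/eqP; rewrite -subr_eq0; apply/eqP.
  have FF : Filter (\oo : set_system nat) by exact: _.
  have E := @cvgn_eq _ _ _ 0 N0
    (cvgB (lim p q r l id) (lim p r q l (fun k => (rwt p + rwt l)%N%:Z - k))).
  apply: (E FF) => N NN; apply/eqP; rewrite subr_eq0; apply/eqP.
  have [pN qN rN lN] : [/\ twt wt (rep_ext N p) = rwt p, twt wt (rep_ext N q) = rwt q,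
      twt wt (rep_ext N r) = rwt r & twt wt (rep_ext N l) = rwt l].
    by split; apply: twt_rep_ext; apply: (N0P _ _ NN); lia.
  have := @orbit_const_local _ _ _ _ (G N) _ (tfin N) (@factM _ _ _ _) (@fact1 _ _ _ _)
    (@twt_fact _ _ _ _) _ _ _ (tcP N) (@tconst_fact _ _ _ _) _ (rep_ext N) (level rwt)
    (rep_ext N p) (rep_ext N q) (rep_ext N r) (rep_ext N l) k0.
  have scE : sc N = fun p q r => oc N (rep_ext N p) (rep_ext N q) (rep_ext N r).
    by apply/funext => p'; apply/funext => q'; apply/funext => r'; exact: structure_constE.
  rewrite /= pN qN rN lN /diff scE; apply.
    move=> j; have jM : (j <= M)%N := ltn_ord j.
    by apply: rep_representatives => n nk; apply: (N0P _ _ NN); lia.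
  move=> j; have jM : (j <= M)%N := ltn_ord j.
  by apply: rep_representatives => n nk; apply: (N0P _ _ NN); lia.
Qed.

End Limit.

Theorem theorem2p6 (R : realType) (V : unitary_voa R[i])
    (Phi : homogeneous_onb V)
    (x : nat -> nat) (x_gt0 : forall N, (0 < x N)%N)
    (x_incr : {homo x : M N / (M < N)%N >-> (M < N)%N})
    (G : forall N, {group 'S_(x N)}) (hG : nested_oligomorphic Phi G)
    (Nn : nat -> nat) (B : forall n, {pred {ffun 'I_(x (Nn n)) -> elt Phi}})
    (hB : orbit_representatives G B)
    (f : reps B -> reps B -> reps B -> R[i]^o)
    (hf : forall g1 g2 g3 : reps B,
        structure_const G g1 g2 g3 N @[N --> \oo] --> f g1 g2 g3) :
  exists g0 : reps B,
    (forall i, elt_val (rep_fun g0 i) = vacuum V) /\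
    is_vertex_algebra (limit_vec g0) (limit_mode f).
Proof.
have [g0 g0_vac] := vacuum_rep hB.
exists g0; split=> [i|]; first by rewrite g0_vac elt_val_vac.
exact: (vertex_algebra_of_constants (finite_levels_rwt x_incr hB)
  (limit_constants x_incr hB hf g0_vac)).
Qed.
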